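(* Let $s,n,m$ be positive integers for which the billiard knot in a flat solid torus $T(s,n,m)$ is defined, i.e. $\gcd(s,n)=\gcd(s,m)=1$. Then $Z^{st}(s,n,m)=T(s,n,m)$. In particular, the billiard knots in a flat solid torus are a subfamily of the stable cylinder knots $Z^{st}$.
   Context: Let $g(t)=2\,|t-\lfloor t\rfloor-\tfrac12|$. Knots $T(s,n,m)$. The flat solid torus is $VT=[0,1]^3/\bigl((0,y,z)\sim(1,y,z)\bigr)$. For $\gcd(s,n)=\gcd(s,m)=1$ and $\phi\in[0,1]$ let $T(s,n,m,\phi):[0,1]\to VT$, $t\mapsto(st\bmod 1,\,g(nt),\,g(mt+\phi))$. $VT$ is regarded as a standard unknotted solid torus in $\mathbb R^3$: $(x,y,z)\in VT$ corresponds to the point with cylindrical coordinates (angle, radius, height) $(2\pi x,\,1+y,\,z)$. $T(s,n,m)$ is the knot $T(s,n,m,\phi)$ for any $\phi$ for which the curve has no self-intersections; such $\phi$ exist and the knot is independent of the choice up to mirror image. Knots $Z(s,an,am)^{(a)}$. Let $\gcd(s,n)=1$, let $a\ge1$ be an integer with $an\ge 2s+1$ and put $\beta=2\pi/a$. Consider the polygonal path $P:[0,1]\to\mathbb C$, parametrized proportionally to arclength, through the points $P(k/n)=e^{iks\beta/n}$, $k=0,\dots,n$. It avoids $0$; write $P(t)=r(t)e^{i\theta(t)}$ with $\theta$ continuous, $\theta(0)=0$, so $\theta(1)=s\beta$. For $\phi\in[0,1]$ consider the closed curve $t\mapsto\bigl(r(t)e^{2\pi i\theta(t)/\beta},\,g(mt+\phi)\bigr)\in\mathbb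 C\times\mathbb R=\mathbb R^3$, $t\in[0,1]$ (the billiard curve in a slice of angle $2\pi/a$ of the cylinder $D^2\times[0,1]$ with identified radial faces). $Z(s,an,am)^{(a)}$ is the knot given by this curve for any $\phi$ for which it has no self-intersections; it is independent of the choice up to mirror image. Stable cylinder knots. $Z^{st}(s,n,m)=\lim_{a\to\infty}Z(s,an,am)^{(a)}$, i.e. the common knot $Z(s,an,am)^{(a)}$ for all sufficiently large $a$ (for $\gcd(s,n)=1$ these knots are equal for all large $a$). Equality of knots: $K_1=K_2$ means that $K_1$ is equivalent to one of $K_2,-K_2,K_2^*,-K_2^*$, where $-K$ is $K$ with reversed orientation and $K^*$ is the mirror image. *)

(* Defs.v *)
(* MathComp-Analysis; R : realType, R^3 is R * R * R with the product topology
   and C is R * R. *)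
From HB Require Import structures.
From mathcomp Require Import all_boot all_order all_algebra.
From mathcomp Require Import all_classical all_reals all_analysis.
Import Order.TTheory GRing.Theory Num.Theory.
Import numFieldNormedType.Exports.

Set Implicit Arguments.
Unset Strict Implicit.
Unset Printing Implicit Defensive.

Local Open Scope classical_set_scope.
Local Open Scope ring_scope.

Definition frac (R : realType) (t : R) : R := t - (Num.floor t)%:~R.

Definition g (R : realType) (t : R) : R := 2 * `|frac t - 2^-1|.

(* A parametrized oriented knot.  Only the restriction of c to [0, 1] matters. *)
Definition is_knot (R : realType) (c : R -> R * R * R) : Prop :=
  [/\ {within `[0, 1], continuous c}, c 0 = c 1 &
      forall t1 t2, 0 <= t1 < 1 -> 0 <= t2 < 1 -> c t1 = c t2 -> t1 = t2].

Definition homeomorphism (T : topologicalType) (f : T -> T) : Prop :=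
  continuous f /\ exists h : T -> T, [/\ continuous h, cancel f h & cancel h f].

Definition ambient_isotopy (R : realType)
    (H : R -> R * R * R -> R * R * R) : Prop :=
  [/\ {within setT `*` `[0, 1],
        continuous (fun q : (R * R * R) * R => H q.2 q.1)},
      forall p, H 0 p = p &
      forall tau, 0 <= tau <= 1 -> homeomorphism (H tau)].

(* Lifts to R of the orientation-preserving homeomorphisms of R/Z. *)
Definition circle_reparam (R : realType) (u : R -> R) : Prop :=
  [/\ continuous u, {homo u : x y / x < y} & forall t, u (t + 1) = u t + 1].

(* Equivalence of oriented knots.  The circle is R/Z, and [c2 \o frac] is the
   periodic extension of c2, so u may also move the base point. *)
Definition knot_equiv (R : realType) (c1 c2 : R -> R * R * R) : Prop :=
  exists H u, [/\ ambient_isotopy H, circle_reparam u &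
    forall t, 0 <= t <= 1 -> H 1 (c1 t) = c2 (frac (u t))].

Definition knot_reverse (R : realType) (c : R -> R * R * R) : R -> R * R * R :=
  fun t => c (1 - t).

Definition knot_mirror (R : realType) (c : R -> R * R * R) : R -> R * R * R :=
  fun t => let: (x, y, z) := c t in (x, y, - z).

Definition knot_eq (R : realType) (c1 c2 : R -> R * R * R) : Prop :=
  [\/ knot_equiv c1 c2, knot_equiv c1 (knot_reverse c2),
      knot_equiv c1 (knot_mirror c2) |
      knot_equiv c1 (knot_reverse (knot_mirror c2))].

(* K is "the" knot of a family of curves indexed by a phase phi in [0, 1]: some
   phase gives a curve without self-intersections, and all such phases give K. *)
Definition knot_of_family (R : realType) (F : R -> R -> R * R * R)
    (K : R -> R * R * R) : Prop :=
  [/\ is_knot K,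
      exists2 phi, 0 <= phi <= 1 & is_knot (F phi) &
      forall phi, 0 <= phi <= 1 -> is_knot (F phi) -> knot_eq (F phi) K].

(* The standard embedding of the flat solid torus VT in R^3. *)
Definition VT_embed (R : realType) (p : R * R * R) : R * R * R :=
  let: (x, y, z) := p in
  ((1 + y) * cos (2 * pi * x), (1 + y) * sin (2 * pi * x), z).

Definition T_curve (R : realType) (s n m : nat) (phi t : R) : R * R * R :=
  VT_embed (frac (s%:R * t), g (n%:R * t), g (m%:R * t + phi)).

(* K is T(s, n, m). *)
Definition T_knot (R : realType) (s n m : nat) (K : R -> R * R * R) : Prop :=
  knot_of_family (T_curve s n m) K.

(* The polygonal path with vertices e^(i k s beta / n).  Its edges have equal
   length, so parametrizing it proportionally to arclength amounts to affine
   interpolation on each [k/n, (k+1)/n]. *)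
Definition slice_path (R : realType) (s n : nat) (beta t : R) : R * R :=
  let k : R := (Num.floor (n%:R * t))%:~R in
  let w := frac (n%:R * t) in
  let alpha := s%:R * beta / n%:R in
  ((1 - w) * cos (k * alpha) + w * cos ((k + 1) * alpha),
   (1 - w) * sin (k * alpha) + w * sin ((k + 1) * alpha)).

(* Polar coordinates (r, theta) along a path in C avoiding 0; they are
   determined by P on [0, 1]. *)
Definition polar_lift (R : realType) (P : R -> R * R) (r theta : R -> R) :
    Prop :=
  [/\ {within `[0, 1], continuous theta}, theta 0 = 0 &
      forall t, 0 <= t <= 1 ->
        0 < r t /\ P t = (r t * cos (theta t), r t * sin (theta t))].

Definition Z_curve (R : realType) (m : nat) (beta : R) (r theta : R -> R)
    (phi t : R) : R * R * R :=
  (r t * cos (2 * pi * theta t / beta),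
   r t * sin (2 * pi * theta t / beta),
   g (m%:R * t + phi)).

(* K is Z(s, an, am)^(a). *)
Definition Z_knot (R : realType) (s n m a : nat) (K : R -> R * R * R) : Prop :=
  let beta : R := 2 * pi / a%:R in
  [/\ coprime s n, (1 <= a)%N, (2 * s + 1 <= a * n)%N &
      exists r theta, polar_lift (slice_path s n beta) r theta /\
        knot_of_family (Z_curve m beta r theta) K].

(* K is Z^st(s, n, m). *)
Definition Zst_knot (R : realType) (s n m : nat) (K : R -> R * R * R) : Prop :=
  exists a0 : nat, forall a : nat, (a0 <= a)%N -> Z_knot s n m a K.

Definition flat_torus_billiard_knot (R : realType) (K : R -> R * R * R) : Prop :=
  exists s n m : nat, [/\ (0 < s)%N, (0 < n)%N & (0 < m)%N] /\
    [/\ coprime s n, coprime s m & T_knot s n m K].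

Definition stable_cylinder_knot (R : realType) (K : R -> R * R * R) : Prop :=
  exists s n m : nat, [/\ (0 < s)%N, (0 < n)%N & (0 < m)%N] /\
    coprime s n /\ Zst_knot s n m K.

(* Main.v *)
Require Import Defs.
From mathcomp Require Import all_boot all_order all_algebra.
From mathcomp Require Import all_classical all_reals all_analysis.
From mathcomp Require Import ring lra.
Import Order.TTheory GRing.Theory Num.Theory.
(* The order matters: frac is to denote the fractional part of a real number
   and not the representative of an element of a fraction field. *)
Import numFieldNormedType.Exports Defs.

Set Implicit Arguments.
Unset Strict Implicit.
Unset Printing Implicit Defensive.

Local Open Scope classical_set_scope.
Local Open Scope ring_scope.

(** Why the two families agree.  Put h = pi s / (a n), half the angle under
    which one edge of the polygon in the slice is seen from the centre.  Follow
    the slice curve not by arclength but by the angle 2 pi s x that it has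
    swept.  On each edge arclength and angle are related by the tangent
    function, so the time becomes t = w(x), where w commutes with the shift by
    1/n, is odd, and tends uniformly to the identity as a grows
    ([slice_param], [chord_near]).  In this parameter the slice curve has angle
    2 pi s x, a radius that is an increasing function of g(nx)
    ([slice_pathE]) and height g(m w(x) + phi), while T(s, n, m, phi) has angle
    2 pi s x, radius 1 + g(nx) and height g(m x + phi).  A radial homeomorphism
    of space ([stretch]) makes the radii equal.  What remains to be compared
    are two curves of the form [torus_curve w phi], which have the same
    projection to the horizontal plane and differ only in their heights.

    Such a comparison is made by [vertical_isotopy]: if two closed curves have
    the same planar projection and pass over and under in the same way at every
    double point, with a Lipschitz control that compactness supplies, then a
    height function on all of space, increasing on vertical lines and
    bi-Lipschitz there, carries one to the other; it is a McShane type
    extension.  This replaces a general isotopy extension theorem.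

    The double points of the projection are pairs x, y with s(x - y) and
    n(x + y) integers ([double_point]).  There the heights g(m w(x) + phi) and
    g(m w(y) + phi) agree only if m(w(x) - w(y)) is an integer, which is
    excluded because s and m are coprime and w is close to the identity, or if
    m(w(x) + w(y)) + 2 phi = m(x + y) + 2 phi is an integer, which does not
    depend on w and happens exactly for the finitely many [singular] phases
    ([levels_differ]).  So on the straight path from (w, phi) to (w', phi') no
    crossing changes as long as no singular phase is met
    ([levels_same_order], [torus_curve_equiv]).  In particular, for all large a
    and each nonsingular phi, Z(s, an, am) at phi is T(s, n, m) at phi.

    Finally T(s, n, m, phi) depends on the phase only up to symmetry.  Shifting
    t by j/n rotates the torus and adds mj/n to the phase, and t -> -t changes
    the sign of the phase; these operations permute the intervals between
    consecutive singular phases transitively ([all_phases_equivalent]).  Hence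
    one curve, T(s, n, m) at a fixed [base_phase], represents both T(s, n, m)
    and Z(s, an, am) for all large a, and everything follows because knot
    equality is an equivalence relation ([knot_eq_sym], [knot_eq_trans]). *)

(** * Real functions, fractional parts and the triangular wave *)

(** The wave g and the reparametrizations below are given by one formula on each
    closed interval between consecutive integers.  Two points at distance at most
    1 are either in one such interval or separated by one integer, where the two
    estimates add up. *)
Lemma cellwise_lipschitz (R : realType) (f : R -> R) (C : R) :
  (forall (k : int) x y, k%:~R <= x <= k%:~R + 1 -> k%:~R <= y <= k%:~R + 1 ->
     `|f x - f y| <= C * `|x - y|) ->
  forall x y, `|x - y| <= 1 -> `|f x - f y| <= C * `|x - y|.
Proof.
move=> fC x y; wlog lexy : x y / x <= y => [wl|].
  case: (leP x y) => [|/ltW yx xy1]; first exact: wl.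
  by rewrite distrC [X in _ * X]distrC; apply: wl => //; rewrite distrC.
rewrite [X in X <= 1]distrC ger0_norm ?subr_ge0// => xy1.
have /andP[x1 x2] := floor_itv x; set k := Num.floor x in x1 x2.
rewrite intrD /= in x2.
have [yk|ky] := leP y (k%:~R + 1).
  by apply: (fC k); apply/andP; split; lra.
have h1 : `|f x - f (k%:~R + 1)| <= C * `|x - (k%:~R + 1)|.
  by apply: (fC k); apply/andP; split; lra.
have h2 : `|f (k%:~R + 1) - f y| <= C * `|k%:~R + 1 - y|.
  by apply: (fC (k + 1)); rewrite intrD /=; apply/andP; split; lra.
have := ler_normD (f x - f (k%:~R + 1)) (f (k%:~R + 1) - f y).
rewrite addrA subrK => h3.
move: h1 h2; rewrite !(ler0_norm (x := _ - y)) ?(ler0_norm (x := x - _)); [|lra..].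
by move=> h1 h2; apply: (le_trans h3); lra.
Qed.

Lemma locally_lipschitz_continuous (R : realType) (f : R -> R) (C : R) :
  (forall x y, `|x - y| <= 1 -> `|f x - f y| <= C * `|x - y|) -> continuous f.
Proof.
move=> fC x; apply/cvgrPdist_lt => e e0; near=> y.
have C0 : 0 < `|C| + 1 by rewrite ltr_pwDr.
have xy : `|x - y| <= 1.
  by near: y; apply: (@cvgr_dist_le _ _ _ _ _ id) => //; exact: cvg_id.
have xye : `|x - y| < e / (`|C| + 1).
  near: y; apply: (@cvgr_dist_lt _ _ _ _ _ id); first exact: cvg_id.
  by rewrite divr_gt0.
apply: (le_lt_trans (fC _ _ xy)).
move: xye; rewrite ltr_pdivlMr // => xye; apply: le_lt_trans xye.
rewrite mulrC ler_wpM2l // (le_trans (ler_norm _)) // lerDl //.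
Unshelve. all: end_near. Qed.

(** A monotone function without gaps in its range has no jumps. *)
Lemma increasing_onto_continuous (R : realType) (f h : R -> R) :
  {homo f : x y / x < y} -> cancel h f -> continuous f.
Proof.
move=> fi hK x; apply/cvgrPdist_lt => e e0.
have fm : {mono f : a b / a < b} by apply: leW_mono; exact: le_mono.
near=> y.
have y1 : h (f x - e) < y.
  by near: y; apply: lt_nbhsr; rewrite -fm hK; lra.
have y2 : y < h (f x + e).
  by near: y; apply: lt_nbhsl; rewrite -fm hK; lra.
by rewrite -fm hK in y1; rewrite -fm hK in y2; rewrite ltr_distl; lra.
Unshelve. all: end_near. Qed.

Lemma increasing_inverse (R : realType) (f : R -> R) :
  continuous f -> {homo f : x y / x < y} ->
  (forall y, exists x1 x2, f x1 <= y <= f x2) ->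
  exists h, [/\ continuous h, {homo h : x y / x < y}, cancel f h & cancel h f].
Proof.
move=> fc fi fs.
have fm : {mono f : a b / a < b} by apply: leW_mono; exact: le_mono.
have fme : {mono f : a b / a <= b} by exact: le_mono.
have /choice[h hK] : forall y, exists x, f x = y.
  move=> y; have [x1 [x2 /andP[h1 h2]]] := fs y.
  have x12 : x1 <= x2 by rewrite -fme (le_trans h1).
  have [||c _ fcy] := @IVT R f x1 x2 y x12; last by exists c.
    exact: continuous_subspaceT.
  by rewrite min_l ?max_r ?h1 ?h2 // fme.
have hi : {homo h : x y / x < y} by move=> x y xy; rewrite -fm !hK.
have fK : cancel f h.
  by move=> x; apply: (inc_inj fme); rewrite hK.
by exists h; split=> //; exact: (increasing_onto_continuous hi fK).
Qed.

Section Frac.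
Context (R : realType).
Implicit Types t x y : R.

Lemma frac_itv t : 0 <= frac t < 1.
Proof. by have := floor_itv t; rewrite intrD /frac; lra. Qed.

Lemma fracB_int t : t - frac t \is a Num.int.
Proof. by rewrite /frac subKr intr_int. Qed.

Lemma floor_frac_unique t (k : int) : k%:~R <= t < k%:~R + 1 ->
  Num.floor t = k /\ frac t = t - k%:~R.
Proof. by move=> h; rewrite /frac (floor_def (m := k)) // intrD. Qed.

Lemma frac_id t : 0 <= t < 1 -> frac t = t.
Proof. by move=> h; have [|_ ->] := @floor_frac_unique t 0; rewrite ?add0r ?subr0. Qed.

Lemma int_lt1 t : t \is a Num.int -> `|t| < 1 -> t = 0.
Proof.
move=> /intrP[k ->]; rewrite -intr_norm -[1]/(1%:~R) ltr_int => k1.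
suff /eqP -> : k == 0 by [].
by rewrite -normr_eq0; move: k1 (normr_ge0 k); case: `|k| => [[|?]|].
Qed.

(** Two fractional parts differ by less than 1, and here by an integer. *)
Lemma frac_eq x y : x - y \is a Num.int -> frac x = frac y.
Proof.
move=> h; have := frac_itv x; have := frac_itv y => hy hx.
apply/eqP; rewrite -subr_eq0; apply/eqP; apply: int_lt1.
  have -> : frac x - frac y = (x - y) - (x - frac x) + (y - frac y) by ring.
  exact: rpredD (rpredB h (fracB_int x)) (fracB_int y).
by rewrite ltr_distl; lra.
Qed.

Lemma eq_mod1 x y : 0 <= x < 1 -> 0 <= y < 1 -> x - y \is a Num.int -> x = y.
Proof. by move=> hx hy /frac_eq; rewrite !frac_id. Qed.

(** All closed curves are handled as 1-periodic functions on the line, which makes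
    the seam at t = 0 = 1 disappear. *)
Definition periodic1 (T : Type) (c : R -> T) := forall t, c (t + 1) = c t.

Lemma periodic_int (T : Type) (c : R -> T) : periodic1 c ->
  forall x y, x - y \is a Num.int -> c x = c y.
Proof.
move=> c1.
have cn : forall (n : nat) x, c (x + n%:R) = c x.
  by elim=> [|n IH] x; rewrite ?addr0 // -natr1 addrA c1 IH.
move=> x y /intrP[[n|n] /eqP]; rewrite subr_eq addrC => /eqP ->; first by rewrite cn.
by rewrite NegzE intrN -(cn n.+1 (y - _)) subrK.
Qed.

Lemma periodic_frac (T : Type) (c : R -> T) : periodic1 c ->
  forall t, c (frac t) = c t.
Proof. by move=> h t; apply/esym/periodic_int/fracB_int. Qed.

(** The right endpoint is included: the wave is continuous there although the floor
    jumps. *)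
Lemma g_cell (k : int) t : k%:~R <= t <= k%:~R + 1 ->
  g t = 2 * `|t - k%:~R - 2^-1|.
Proof.
move=> /andP[kt]; rewrite /g le_eqVlt => /predU1P[->|tk]; last first.
  by have [|_ ->] := @floor_frac_unique t k; rewrite ?kt.
have [|_ ->] := @floor_frac_unique (k%:~R + 1) (k + 1); rewrite ?intrD ?lexx ?ltrDl //=.
by rewrite ler0_norm ?ger0_norm; lra.
Qed.

Lemma g_lipschitz x y : `|x - y| <= 1 -> `|g x - g y| <= 2 * `|x - y|.
Proof.
apply: cellwise_lipschitz => k a b ha hb.
rewrite !(@g_cell k) // -mulrBr normrM ger0_norm // ler_wpM2l //.
apply: (le_trans (ler_dist_dist _ _)).
by have -> : a - k%:~R - 2^-1 - (b - k%:~R - 2^-1) = a - b by ring.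
Qed.

Lemma continuous_g : continuous (@g R).
Proof. exact: locally_lipschitz_continuous g_lipschitz. Qed.

Lemma g_int x y : x - y \is a Num.int -> g x = g y.
Proof. by move=> h; rewrite /g (frac_eq h). Qed.

Lemma gN t : g (- t) = g t.
Proof.
have := floor_itv t; rewrite intrD; set k := Num.floor t => /andP[k1 k2].
rewrite (@g_cell k t) ?k1 ?ltW // (@g_cell (- k - 1) (- t)) ?intrB ?intrN /=; last first.
  by apply/andP; split; lra.
by rewrite -normrN; congr (_ * `| _ |); lra.
Qed.

Lemma g_neg x y : x + y \is a Num.int -> g x = g y.
Proof. by move=> h; rewrite -(gN y); apply: g_int; rewrite opprK. Qed.

Lemma g_itv t : 0 <= g t <= 1.
Proof.
have := frac_itv t; rewrite /g => h; rewrite mulr_ge0 //=.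
have : `|frac t - 2^-1| <= 2^-1 by rewrite ler_distl; lra.
lra.
Qed.

(** The wave folds the circle R/Z along the reflection t -> - t, and nothing else is
    identified. *)
Lemma g_eq x y : g x = g y -> x - y \is a Num.int \/ x + y \is a Num.int.
Proof.
have h1 := fracB_int x; have h2 := fracB_int y.
rewrite /g => /(mulfI (negbT (eqr_nat R 2 0)))/eqP; rewrite eqr_norm2 => /orP[]/eqP e.
  left; have -> : x - y = (x - frac x) - (y - frac y) + 0.
    by rewrite -(subrr (frac x - 2^-1)) {2}e; ring.
  by rewrite addr0 rpredB.
right; have -> : x + y = (x - frac x) + (y - frac y) + 1.
  by have := e; lra.
exact: rpredD (rpredD h1 h2) (rpred1 _).
Qed.

End Frac.

(** * Ambient isotopies and knot equality *)

Lemma continuous_pairing (T U V : topologicalType) (f : T -> U) (h : T -> V) :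
  continuous f -> continuous h -> continuous (fun x => (f x, h x)).
Proof. by move=> cf ch x; apply: cvg_pair; [exact: cf|exact: ch]. Qed.

Lemma continuous_proj1 (T U V : topologicalType) (f : T -> U * V) :
  continuous f -> continuous (fun x => (f x).1).
Proof. by move=> cf x; apply: cvg_comp (cf x) _; exact: cvg_fst. Qed.

Lemma continuous_proj2 (T U V : topologicalType) (f : T -> U * V) :
  continuous f -> continuous (fun x => (f x).2).
Proof. by move=> cf x; apply: cvg_comp (cf x) _; exact: cvg_snd. Qed.

Lemma within_continuous_comp (T U V : topologicalType) (A : set T) (B : set U)
    (f : T -> U) (h : U -> V) :
  (forall x, A x -> B (f x)) -> {within A, continuous f} ->
  {within B, continuous h} -> {within A, continuous (fun x => h (f x))}.
Proof.
move=> AB /subspace_continuousP cf /subspace_continuousP ch.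
apply/subspace_continuousP => x Ax W /(ch _ (AB _ Ax)); rewrite !nbhs_simpl => BW.
have {}cf : nbhs x (fun y => A y -> B (f y) -> W (h (f y))) := cf x Ax _ BW.
change (nbhs x (fun y => A y -> W (h (f y)))).
by apply: filterS cf => y /= hy Ay; exact: hy Ay (AB _ Ay).
Qed.

Lemma within_continuous_pairing (T U V : topologicalType) (A : set T)
    (f : T -> U) (h : T -> V) :
  {within A, continuous f} -> {within A, continuous h} ->
  {within A, continuous (fun x => (f x, h x))}.
Proof. by move=> cf ch x; apply: cvg_pair; [exact: cf|exact: ch]. Qed.

Section Equivalence.
Context (R : realType).
Local Notation R3 := (R * R * R)%type.
Implicit Types (c : R -> R3) (H : R -> R3 -> R3) (u : R -> R).

Definition mirror3 (p : R3) : R3 := (p.1.1, p.1.2, - p.2).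

Lemma knot_mirrorE c : knot_mirror c = fun t => mirror3 (c t).
Proof. by apply/funext => t; rewrite /knot_mirror /mirror3; case: (c t) => [[]]. Qed.

Lemma mirror3K : involutive mirror3.
Proof. by move=> [[x y] z]; rewrite /mirror3 /= opprK. Qed.

Lemma continuous_mirror3 : continuous mirror3.
Proof.
have c1 := continuous_proj1 (fun p : R3 => @cvg_id _ (nbhs p)).
have c2 := continuous_proj2 (fun p : R3 => @cvg_id _ (nbhs p)).
apply: continuous_pairing; last by move=> p; apply: continuousN; exact: c2.
by apply: continuous_pairing; [exact: continuous_proj1|exact: continuous_proj2].
Qed.

Lemma homeo_comp (f h : R3 -> R3) : homeomorphism f -> homeomorphism h ->
  homeomorphism (fun p => h (f p)).
Proof.
move=> [cf [f' [cf' fK fK']]] [ch [h' [ch' hK hK']]]; split.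
  by move=> p; apply: continuous_comp; [exact: cf|exact: ch].
exists (fun p => f' (h' p)); split.
- by move=> p; apply: continuous_comp; [exact: ch'|exact: cf'].
- by move=> p; rewrite hK fK.
- by move=> p; rewrite fK' hK'.
Qed.

Lemma homeo_mirror3 : homeomorphism mirror3.
Proof.
split; first exact: continuous_mirror3.
by exists mirror3; split; [exact: continuous_mirror3|exact: mirror3K..].
Qed.

Lemma unit_itv_refl (q : R3 * R) : (setT `*` `[0, 1]) q = (0 <= q.2 <= 1) :> Prop.
Proof. by apply/propext; rewrite /= in_itv /=; split => [[]|]. Qed.

Lemma isotopy_of_continuous H :
  continuous (fun q : R3 * R => H q.2 q.1) -> (forall p, H 0 p = p) ->
  (forall tau, 0 <= tau <= 1 -> homeomorphism (H tau)) -> ambient_isotopy H.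
Proof. by move=> ch h0 hh; split=> //; exact: continuous_subspaceT. Qed.

Lemma isotopy_comp H1 H2 : ambient_isotopy H1 -> ambient_isotopy H2 ->
  ambient_isotopy (fun tau p => H2 tau (H1 tau p)).
Proof.
move=> [c1 z1 h1] [c2 z2 h2]; split.
- apply: (@within_continuous_comp _ _ _ _ _ (fun q : R3 * R => (H1 q.2 q.1, q.2)) _ _ _ c2).
    by move=> q; rewrite !unit_itv_refl.
  apply: within_continuous_pairing => //; apply: continuous_subspaceT.
  by apply: continuous_proj2 => q; exact: cvg_id.
- by move=> p; rewrite z1 z2.
- by move=> tau ht; apply: homeo_comp; [exact: h1|exact: h2].
Qed.

Lemma isotopy_conj H (i : R3 -> R3) : homeomorphism i -> involutive i ->
  ambient_isotopy H -> ambient_isotopy (fun tau p => i (H tau (i p))).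
Proof.
move=> hi iK [c1 z1 h1]; split.
- have [ci _] := hi.
  apply: (@within_continuous_comp _ _ _ _ setT (fun q : R3 * R => H q.2 (i q.1))) => //.
    apply: (@within_continuous_comp _ _ _ _ _ (fun q : R3 * R => (i q.1, q.2)) _ _ _ c1).
      by move=> q; rewrite !unit_itv_refl.
    apply: continuous_subspaceT; apply: continuous_pairing.
      move=> q; apply: (@continuous_comp _ _ _ fst i); last exact: ci.
      exact: cvg_fst.
    by apply: continuous_proj2 => q; exact: cvg_id.
  exact: continuous_subspaceT.
- by move=> p; rewrite z1 iK.
- move=> tau ht; apply: (@homeo_comp (fun p => H tau (i p)) i) => //.
  by apply: (@homeo_comp i) => //; exact: h1.
Qed.

(** Running the isotopy backwards after undoing its end, H_(1 - tau) o H_1^(-1),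
    needs only the continuity of the single inverse H_1^(-1), not that of the
    inverse of H_tau in the pair of variables. *)
Lemma isotopy_inverse H : ambient_isotopy H ->
  exists2 H', ambient_isotopy H' & cancel (H 1) (H' 1).
Proof.
move=> [cH z hH]; have [|c1 [h [ch hK hK']]] := hH 1; first by rewrite ler01 lexx.
exists (fun tau p => H (1 - tau) (h p)); last by move=> p; rewrite subrr z hK.
split.
- apply: (@within_continuous_comp _ _ _ _ _ (fun q : R3 * R => (h q.1, 1 - q.2)) _ _ _ cH).
    by move=> q; rewrite !unit_itv_refl /=; lra.
  apply: continuous_subspaceT; apply: continuous_pairing.
    move=> q; apply: (@continuous_comp _ _ _ fst h); last exact: ch.
    exact: cvg_fst.
  move=> q; apply: continuousB; first exact: cvg_cst.
  exact: cvg_snd.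
- by move=> p; rewrite subr0 hK'.
- move=> tau ht; apply: (@homeo_comp h); last by apply: hH; lra.
  by split=> //; exists (H 1).
Qed.

Lemma reparam_id : circle_reparam (@id R).
Proof. by split => // t; exact: cvg_id. Qed.

Lemma reparam_int u : circle_reparam u -> forall x y, x - y \is a Num.int ->
  u x - u y \is a Num.int.
Proof.
move=> [_ _ u1] x y xy.
have -> : u x - u y = ((u x - x) - (u y - y)) + (x - y) by ring.
have p1 : periodic1 (fun t => u t - t) by move=> t; rewrite u1; ring.
by rewrite (periodic_int p1 xy) subrr add0r.
Qed.

Lemma reparam_comp u v : circle_reparam u -> circle_reparam v ->
  circle_reparam (fun t => v (u t)).
Proof.
move=> [cu iu u1] [cv iv v1]; split.
- by move=> t; apply: continuous_comp; [exact: cu|exact: cv].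
- by move=> x y /iu /iv.
- by move=> t; rewrite u1 v1.
Qed.

(** Surjectivity comes from u(k) = u(0) + k, which leaves every real number between
    two consecutive values. *)
Lemma reparam_inverse u : circle_reparam u ->
  exists v, [/\ circle_reparam v, cancel u v & cancel v u].
Proof.
move=> uR; have [cu iu u1] := uR.
have [|v [cv iv uK vK]] := increasing_inverse cu iu.
  move=> y; pose k := Num.floor (y - u 0); exists k%:~R, (k%:~R + 1).
  have uk : u k%:~R = u 0 + k%:~R.
    have p1 : periodic1 (fun t => u t - t) by move=> t; rewrite u1; ring.
    have := periodic_int p1 (x := k%:~R) (y := 0); rewrite subr0 => /(_ (intr_int _ _)).
    by lra.
  by rewrite u1 uk; have := floor_itv (y - u 0); rewrite intrD -/k; lra.
exists v; split=> //; split=> // t.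
by rewrite -{1}(vK t) -u1 uK.
Qed.

Definition closed_curve c := c 0 = c 1.

Lemma knot_closed c : is_knot c -> closed_curve c.
Proof. by case. Qed.

Lemma knot_equiv_trans c1 c2 c3 :
  knot_equiv c1 c2 -> knot_equiv c2 c3 -> knot_equiv c1 c3.
Proof.
move=> [H [u [hH hu e1]]] [H' [u' [hH' hu' e2]]].
exists (fun tau p => H' tau (H tau p)), (fun t => u' (u t)).
split; [exact: isotopy_comp|exact: reparam_comp|move=> t ht].
rewrite e1 // e2; last by have := frac_itv (u t); lra.
congr c3; apply: frac_eq; apply: reparam_int => //.
by rewrite -opprB rpredN fracB_int.
Qed.

(** Closedness serves for the parameter t = 1 only: the periodic extension reads the
    value of c2 there from c2 0. *)
Lemma knot_equiv_sym c1 c2 : closed_curve c2 -> knot_equiv c1 c2 -> knot_equiv c2 c1.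
Proof.
move=> cl [H [u [hH hu e]]].
have [H' hH' HK] := isotopy_inverse hH.
have [v [hv uK vK]] := reparam_inverse hu.
exists H', v; split=> // t ht.
have E x : 0 <= x < 1 -> c2 x = H 1 (c1 (frac (v x))).
  move=> hx; rewrite e; last by have := frac_itv (v x); lra.
  congr c2; rewrite -{1}(frac_id hx) -{1}(vK x); apply: frac_eq.
  by apply: reparam_int => //; exact: fracB_int.
have [t1|t1] := eqVneq t 1.
  rewrite t1 -cl (E 0) ?lexx ?ltr01 // HK; congr c1; apply: frac_eq.
  by apply: reparam_int => //; rewrite sub0r rpredN rpred1.
by rewrite (E t) ?HK // [t < 1]lt_neqAle t1.
Qed.

(** The second case is the seam, where reversal and taking fractional parts do not
    commute; closed curves do not feel it. *)
Lemma frac_opp (y : R) : frac (1 - y) = 1 - frac y \/ (frac y = 0 /\ frac (1 - y) = 0).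
Proof.
have := frac_itv y; have := fracB_int y => hi hy.
have [y0|y0] := eqVneq (frac y) 0.
  right; split=> //; rewrite -[RHS](@frac_id R 0) ?lexx ?ltr01 //.
  by apply: frac_eq; rewrite y0 !subr0 in hi *; rewrite rpredB ?rpred1.
left; rewrite -[RHS]frac_id; last by move: y0; rewrite neq_lt => /orP[]; lra.
apply: frac_eq; have -> : 1 - y - (1 - frac y) = - (y - frac y) by ring.
by rewrite rpredN.
Qed.

Lemma knot_equiv_reverse c1 c2 : closed_curve c2 ->
  knot_equiv c1 c2 -> knot_equiv (knot_reverse c1) (knot_reverse c2).
Proof.
move=> cl [H [u [hH [cu iu u1] e]]]; exists H, (fun t => 1 - u (1 - t)).
split=> //.
  split.
  - move=> t; apply: continuousB; first exact: cvg_cst.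
    apply: continuous_comp; last exact: cu.
    by apply: continuousB; [exact: cvg_cst|exact: cvg_id].
  - by move=> x y xy; rewrite ltrD2l ltrN2 iu // ltrD2l ltrN2.
  - move=> t; have := u1 (1 - (t + 1)).
    have -> : 1 - (t + 1) + 1 = 1 - t by ring.
    by lra.
move=> t ht; rewrite /knot_reverse e; last by lra.
have [->|[-> ->]] := frac_opp (u (1 - t)); first by rewrite subKr.
by rewrite subr0.
Qed.

Lemma knot_equiv_mirror c1 c2 :
  knot_equiv c1 c2 -> knot_equiv (knot_mirror c1) (knot_mirror c2).
Proof.
move=> [H [u [hH hu e]]]; rewrite !knot_mirrorE.
exists (fun tau p => mirror3 (H tau (mirror3 p))), u; split=> //.
  by apply: isotopy_conj => //; [exact: homeo_mirror3|exact: mirror3K].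
by move=> t ht; rewrite mirror3K e.
Qed.

(** The group generated by reversal and mirror image, indexed by its elements: knot
    equality is equivalence up to this action, and symmetry and transitivity become
    computations with exclusive or. *)
Definition symmetric_copy (b1 b2 : bool) c : R -> R3 :=
  let c' := if b2 then knot_mirror c else c in
  if b1 then knot_reverse c' else c'.

Lemma knot_eqP c1 c2 :
  knot_eq c1 c2 <-> exists b1 b2, knot_equiv c1 (symmetric_copy b1 b2 c2).
Proof.
split=> [[h|h|h|h]|[[] [[] h]]].
- by exists false, false.
- by exists true, false.
- by exists false, true.
- by exists true, true.
- exact: Or44 h.
- exact: Or42 h.
- exact: Or43 h.
- exact: Or41 h.
Qed.

Lemma symmetric_copy_closed b1 b2 c :
  closed_curve c -> closed_curve (symmetric_copy b1 b2 c).
Proof.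
move=> cl; rewrite /symmetric_copy; set c' := if b2 then _ else _.
have cl' : closed_curve c'.
  by rewrite /c'; case: (b2) => //; rewrite knot_mirrorE /closed_curve cl.
by case: b1 => //; rewrite /closed_curve /knot_reverse subr0 subrr cl'.
Qed.

Lemma symmetric_copyA b1 b2 d1 d2 c :
  symmetric_copy b1 b2 (symmetric_copy d1 d2 c) = symmetric_copy (b1 (+) d1) (b2 (+) d2) c.
Proof.
apply/funext => t; rewrite /symmetric_copy.
by case: b1; case: b2; case: d1; case: d2;
  rewrite /= ?knot_mirrorE /knot_reverse ?knot_mirrorE ?subKr ?mirror3K.
Qed.

Lemma symmetric_copy_equiv b1 b2 c1 c2 : closed_curve c2 -> knot_equiv c1 c2 ->
  knot_equiv (symmetric_copy b1 b2 c1) (symmetric_copy b1 b2 c2).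
Proof.
move=> cl e; have e2 := knot_equiv_mirror e.
have := symmetric_copy_closed false b2 cl.
rewrite /symmetric_copy; case: b1; case: b2 => //= cl'; exact: knot_equiv_reverse.
Qed.

Lemma knot_eq_sym c1 c2 : closed_curve c1 -> closed_curve c2 ->
  knot_eq c1 c2 -> knot_eq c2 c1.
Proof.
move=> cl1 cl2 /knot_eqP[b1 [b2 e]]; apply/knot_eqP; exists b1, b2.
have := knot_equiv_sym (symmetric_copy_closed b1 b2 cl2) e.
move=> /(symmetric_copy_equiv b1 b2 cl1).
by rewrite symmetric_copyA !addbb.
Qed.

Lemma knot_eq_trans c1 c2 c3 : closed_curve c3 ->
  knot_eq c1 c2 -> knot_eq c2 c3 -> knot_eq c1 c3.
Proof.
move=> cl3 /knot_eqP[b1 [b2 e]] /knot_eqP[d1 [d2 f]]; apply/knot_eqP.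
exists (b1 (+) d1), (b2 (+) d2); rewrite -symmetric_copyA.
by apply: knot_equiv_trans e _; apply: symmetric_copy_equiv => //; exact: symmetric_copy_closed.
Qed.

Lemma knot_eq_of_equiv c1 c2 : knot_equiv c1 c2 -> knot_eq c1 c2.
Proof. by move=> e; exact: Or41. Qed.

Lemma knot_equiv_loops H u c1 c2 : ambient_isotopy H -> circle_reparam u ->
  periodic1 c2 -> (forall t, H 1 (c1 t) = c2 (u t)) -> knot_equiv c1 c2.
Proof. by move=> hH hu p2 e; exists H, u; split=> // t _; rewrite e periodic_frac. Qed.

(** Embeddedness of a closed curve, free of a choice of fundamental domain. *)
Lemma loop_knotP c : continuous c -> periodic1 c ->
  is_knot c <-> (forall x y, c x = c y -> x - y \is a Num.int).
Proof.
move=> cc p1; split.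
  move=> [_ _ inj] x y; rewrite -(periodic_frac p1 x) -(periodic_frac p1 y).
  move=> /(inj _ _ (frac_itv _) (frac_itv _)) e.
  have -> : x - y = (x - frac x) - (y - frac y) by rewrite e; ring.
  by rewrite rpredB ?fracB_int.
move=> inj; split; first exact: continuous_subspaceT.
  by rewrite -(p1 0) add0r.
by move=> x y hx hy /inj; exact: eq_mod1.
Qed.

Lemma is_knot_ext c1 c2 : (forall t, 0 <= t <= 1 -> c1 t = c2 t) ->
  is_knot c1 -> is_knot c2.
Proof.
move=> e [cc cl inj].
split; last 1 first.
- by move=> x y hx hy; rewrite -(e x) -?(e y); [exact: inj|lra..].
- apply: subspace_eq_continuous cc => t; rewrite inE /= in_itv /= => ht.
  exact: e.
- by rewrite -(e 0) -?(e 1) // ?lexx ler01.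
Qed.

Lemma knot_equiv_ext c1 c2 d1 d2 : (forall t, 0 <= t <= 1 -> c1 t = d1 t) ->
  (forall t, 0 <= t <= 1 -> c2 t = d2 t) -> knot_equiv c1 c2 -> knot_equiv d1 d2.
Proof.
move=> e1 e2 [H [u [hH hu e]]]; exists H, u; split=> // t ht.
by rewrite -e1 // -e2 ?e //; have := frac_itv (u t); lra.
Qed.

Lemma symmetric_copy_ext b1 b2 c1 c2 : (forall t, 0 <= t <= 1 -> c1 t = c2 t) ->
  forall t, 0 <= t <= 1 -> symmetric_copy b1 b2 c1 t = symmetric_copy b1 b2 c2 t.
Proof.
move=> e t ht; rewrite /symmetric_copy.
by case: b1; case: b2; rewrite ?knot_mirrorE /knot_reverse ?e //; lra.
Qed.

Lemma knot_eq_ext c1 c2 d1 d2 : (forall t, 0 <= t <= 1 -> c1 t = d1 t) ->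
  (forall t, 0 <= t <= 1 -> c2 t = d2 t) -> knot_eq c1 c2 -> knot_eq d1 d2.
Proof.
move=> e1 e2 /knot_eqP[b1 [b2 e]]; apply/knot_eqP; exists b1, b2.
by apply: knot_equiv_ext e1 _ e; exact: symmetric_copy_ext.
Qed.

End Equivalence.

(** * Moving a curve along vertical lines *)

Section Vertical.
Context (R : realType).
Local Notation R3 := (R * R * R)%type.

Definition taxicab (p p' : R3) : R :=
  `|p.1.1 - p'.1.1| + `|p.1.2 - p'.1.2| + `|p.2 - p'.2|.

(** All auxiliary functions on space are shown to be continuous through this
    criterion; the sum distance keeps the estimates linear. *)
Lemma taxicab_lipschitz_continuous (f : R3 -> R) (C : R) :
  (forall p p', `|f p - f p'| <= C * taxicab p p') -> continuous f.
Proof.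
move=> fC p; apply/cvgrPdist_lt => e e0.
have C0 : 0 < `|C| + 1 by rewrite ltr_pwDr.
pose d := e / (`|C| + 1) / 3.
have d0 : 0 < d by rewrite !divr_gt0.
have c1 : (p'.1 @[p' --> p] --> p.1)%classic by exact: cvg_fst.
have c2 : (p'.2 @[p' --> p] --> p.2)%classic by exact: cvg_snd.
have c11 : (p'.1.1 @[p' --> p] --> p.1.1)%classic by apply: cvg_comp c1 _; exact: cvg_fst.
have c12 : (p'.1.2 @[p' --> p] --> p.1.2)%classic by apply: cvg_comp c1 _; exact: cvg_snd.
move/cvgrPdist_lt/(_ _ d0): c11 => c11; move/cvgrPdist_lt/(_ _ d0): c12 => c12.
move/cvgrPdist_lt/(_ _ d0): c2 => c2.
near=> p'.
have h1 : `|p.1.1 - p'.1.1| < d by near: p'; exact: c11.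
have h2 : `|p.1.2 - p'.1.2| < d by near: p'; exact: c12.
have h3 : `|p.2 - p'.2| < d by near: p'; exact: c2.
apply: (le_lt_trans (fC _ _)).
have e3 : e = (`|C| + 1) * (3 * d) by rewrite /d; field; lra.
have t0 : 0 <= taxicab p p' by rewrite !addr_ge0.
apply: (@le_lt_trans _ _ ((`|C| + 1) * taxicab p p')).
  by rewrite ler_wpM2r // (le_trans (ler_norm _)) // lerDl.
by rewrite e3 ltr_pM2l // /taxicab; lra.
Unshelve. all: end_near. Qed.

Section Extension.
Context (I : Type) (i0 : I) (p q z0 z1 : I -> R) (eps M L : R).
Hypotheses (eps0 : 0 < eps) (epsM : eps <= M) (L0 : 0 <= L).
Hypothesis separated : forall i j, z0 j <= z0 i ->
  eps * (z0 i - z0 j) - L * (`|p i - p j| + `|q i - q j|) <= z1 i - z1 j <=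
  M * (z0 i - z0 j) + L * (`|p i - p j| + `|q i - q j|).

Let psi (u : R) := Num.min (eps * u) (M * u).

Let psi_slope u v : u <= v -> eps * (v - u) <= psi v - psi u <= M * (v - u).
Proof.
move=> uv; rewrite /psi.
have [u0|u0] := leP 0 u; have [v0|v0] := leP 0 v.
- rewrite !min_l ?ler_wpM2r // -mulrBr lexx /=.
  by rewrite ler_wpM2r // subr_ge0.
- by lra.
- rewrite (min_l (ler_wpM2r v0 epsM)) (min_r (ler_wnM2r (ltW u0) epsM)).
  have h1 := ler_wpM2r v0 epsM; have h2 := ler_wnM2r (ltW u0) epsM.
  by apply/andP; split; lra.
- rewrite !min_r ?(ler_wnM2r (ltW _) epsM) // -mulrBr lexx andbT.
  by rewrite ler_wpM2r // subr_ge0.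
Qed.

Let psi0 : psi 0 = 0.
Proof. by rewrite /psi !mulr0 minxx. Qed.

Let M0 : 0 <= M.
Proof. by rewrite (le_trans (ltW eps0)). Qed.

Let psi_lip u v : psi u <= psi v + M * `|u - v|.
Proof.
have [uv|/ltW vu] := leP u v.
  have /andP[h _] := psi_slope uv.
  have : 0 <= eps * (v - u) by rewrite mulr_ge0 ?subr_ge0 // ltW.
  have : 0 <= M * `|u - v| by rewrite mulr_ge0.
  by lra.
by have /andP[_ h] := psi_slope vu; rewrite ger0_norm ?subr_ge0 //; lra.
Qed.

(** Horizontally it decreases with slope L away from the i-th point; vertically it is
    concave, rising with the small slope eps above that point and falling with the
    large slope M below it.  A supremum of such functions keeps all these slopes. *)
Definition cone (P : R3) (i : I) : R :=
  z1 i + psi (P.2 - z0 i) - L * (`|P.1.1 - p i| + `|P.1.2 - q i|).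

(** A McShane extension of the partial function sending (p i, q i, z0 i) to z1 i,
    adapted so that it is also increasing on vertical lines. *)
Definition envelope (P : R3) : R := sup (range (cone P)).

Let cone_lip P P' i : cone P i <= cone P' i + (M + L) * taxicab P P'.
Proof.
rewrite /cone.
have h1 := psi_lip (P.2 - z0 i) (P'.2 - z0 i).
have e2 : P.2 - z0 i - (P'.2 - z0 i) = P.2 - P'.2 by ring.
have h2 : `|P'.1.1 - p i| <= `|P.1.1 - p i| + `|P.1.1 - P'.1.1|.
  by rewrite [X in _ <= X]addrC (distrC P.1.1 P'.1.1) ler_distD.
have h3 : `|P'.1.2 - q i| <= `|P.1.2 - q i| + `|P.1.2 - P'.1.2|.
  by rewrite [X in _ <= X]addrC (distrC P.1.2 P'.1.2) ler_distD.
have h4 := ler_wpM2l L0 (lerD h2 h3).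
have h5 : 0 <= M * (`|P.1.1 - P'.1.1| + `|P.1.2 - P'.1.2|) by rewrite mulr_ge0.
have h6 : 0 <= L * `|P.2 - P'.2| by rewrite mulr_ge0.
by rewrite e2 in h1; rewrite /taxicab; lra.
Qed.

Let cone_touch i j : cone (p j, q j, z0 j) i <= z1 j.
Proof.
rewrite /cone /=; have [h|h] := leP (z0 j) (z0 i).
  have /andP[_] := separated h.
  rewrite (distrC (p j)) (distrC (q j)).
  have : psi (z0 j - z0 i) <= M * (z0 j - z0 i) by rewrite /psi ge_min lexx orbT.
  by lra.
have /andP[h1 _] := separated (ltW h).
have : psi (z0 j - z0 i) <= eps * (z0 j - z0 i) by rewrite /psi ge_min lexx.
by lra.
Qed.

Let cone_self j : cone (p j, q j, z0 j) j = z1 j.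
Proof. by rewrite /cone /= !subrr psi0 !normr0; ring. Qed.

Let cone_ub P : has_ubound (range (cone P)).
Proof.
exists (z1 i0 + (M + L) * taxicab P (p i0, q i0, z0 i0)) => _ [i _ <-].
apply: (le_trans (cone_lip P (p i0, q i0, z0 i0) i)).
by rewrite lerD2r cone_touch.
Qed.

Let envelope_ge P i : cone P i <= envelope P.
Proof. by apply: ub_le_sup; [exact: cone_ub|exists i]. Qed.

Let envelope_le P b : (forall i, cone P i <= b) -> envelope P <= b.
Proof. by move=> h; apply: ge_sup => [|_ [i _ <-]//]; exists (cone P i0), i0. Qed.

(** The separation hypothesis says precisely that no cone exceeds the prescribed value
    at another point of the curve. *)
Lemma envelope_interpolates j : envelope (p j, q j, z0 j) = z1 j.
Proof.
apply/eqP; rewrite eq_le envelope_le /=; last by move=> i; exact: cone_touch.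
by rewrite -[X in X <= _]cone_self envelope_ge.
Qed.

Lemma envelope_lipschitz P P' :
  `|envelope P - envelope P'| <= (M + L) * taxicab P P'.
Proof.
have E Q Q' : envelope Q <= envelope Q' + (M + L) * taxicab Q Q'.
  by apply: envelope_le => i; apply: (le_trans (cone_lip Q Q' i)); rewrite lerD2r.
rewrite ler_distl; have := E P P'; have := E P' P.
have -> : taxicab P' P = taxicab P P'.
  by rewrite /taxicab distrC [`|P'.1.2 - _|]distrC [`|P'.2 - _|]distrC.
by lra.
Qed.

(** Each cone has vertical slope at least eps, and this survives the supremum. *)
Lemma envelope_increasing x y z z' : z <= z' ->
  eps * (z' - z) <= envelope (x, y, z') - envelope (x, y, z).
Proof.
move=> zz'; rewrite -(lerD2r (envelope (x, y, z))) subrK -lerBrDl.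
apply: envelope_le => i; rewrite lerBrDl; apply: le_trans (envelope_ge _ i).
rewrite /cone /=.
have /andP[h _] := psi_slope (lerB zz' (lexx (z0 i))).
have -> : z' - z = z' - z0 i - (z - z0 i) by ring.
by lra.
Qed.

(** Convex combinations of two increasing functions of the height are increasing, so
    the straight path to the envelope consists of homeomorphisms. *)
Definition lift_heights (tau : R) (P : R3) : R3 :=
  (P.1.1, P.1.2, (1 - tau) * P.2 + tau * envelope P).

Let height tau x y z := (1 - tau) * z + tau * envelope (x, y, z).

Let e1 := Num.min eps 1.

Let e1_gt0 : 0 < e1.
Proof. by rewrite /e1 lt_min eps0 ltr01. Qed.

Let height_slope tau x y z z' : 0 <= tau <= 1 -> z <= z' ->
  e1 * (z' - z) <= height tau x y z' - height tau x y z.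
Proof.
move=> /andP[t0 t1] zz'; rewrite /height.
have h1 : e1 * (z' - z) <= eps * (z' - z).
  by rewrite ler_wpM2r ?subr_ge0 // /e1 ge_min lexx.
have h2 : e1 * (z' - z) <= 1 * (z' - z).
  by rewrite ler_wpM2r ?subr_ge0 // /e1 ge_min lexx orbT.
have h3 := le_trans h1 (envelope_increasing x y zz').
have h4 := ler_wpM2l t0 h3.
have t1' : 0 <= 1 - tau by lra.
have h5 := ler_wpM2l t1' h2.
by lra.
Qed.

Let height_lip tau P P' : 0 <= tau <= 1 ->
  `|(lift_heights tau P).2 - (lift_heights tau P').2| <= (1 + (M + L)) * taxicab P P'.
Proof.
move=> /andP[t0 t1]; rewrite /lift_heights /=.
have -> : (1 - tau) * P.2 + tau * envelope P - ((1 - tau) * P'.2 + tau * envelope P') =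
  (1 - tau) * (P.2 - P'.2) + tau * (envelope P - envelope P') by ring.
apply: (le_trans (ler_normD _ _)); rewrite !normrM.
have T0 : `|P.2 - P'.2| <= taxicab P P' by rewrite /taxicab lerDr addr_ge0.
have h := envelope_lipschitz P P'.
have h1 : `|1 - tau| * `|P.2 - P'.2| <= 1 * taxicab P P'.
  by rewrite ler_pM // ger0_norm; lra.
have h2 : `|tau| * `|envelope P - envelope P'| <= 1 * ((M + L) * taxicab P P').
  by rewrite ler_pM // ger0_norm; lra.
by lra.
Qed.

Let heightE tau x y z : (lift_heights tau (x, y, z)).2 = height tau x y z.
Proof. by []. Qed.

Let height_continuous tau x y : 0 <= tau <= 1 -> continuous (height tau x y).
Proof.
move=> ht; apply: (@locally_lipschitz_continuous _ _ (1 + (M + L))) => z z' _.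
rewrite -!heightE (le_trans (height_lip _ _ ht)) //.
by rewrite /taxicab /= !subrr !normr0 !add0r.
Qed.

(** Along vertical lines the slope is at least min(eps, 1), so the inverse height is
    Lipschitz in all three coordinates. *)
Lemma lift_heights_homeo tau : 0 <= tau <= 1 -> homeomorphism (lift_heights tau).
Proof.
move=> ht.
have hi x y : {homo height tau x y : z z' / z < z'}.
  move=> z z' zz'; rewrite -subr_gt0; apply: lt_le_trans (height_slope x y ht (ltW zz')).
  by rewrite mulr_gt0 ?subr_gt0.
have onto (xy : R * R) : exists h,
    cancel (height tau xy.1 xy.2) h /\ cancel h (height tau xy.1 xy.2).
  have [|h [_ _ hK hK']] := increasing_inverse (height_continuous (x := xy.1) (y := xy.2) ht) (@hi _ _).
    move=> y; set f := height _ _ _; pose b := `|y - f 0| / e1.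
    have b0 : 0 <= b by rewrite divr_ge0 // ltW.
    have be : e1 * b = `|y - f 0| by rewrite /b mulrC divfK // gt_eqF.
    have h1 := height_slope xy.1 xy.2 ht b0.
    have nb0 : - b <= 0 by lra.
    have h2 := height_slope xy.1 xy.2 ht nb0.
    have h3 := ler_norm (y - f 0); have h4 := ler_norm (- (y - f 0)); rewrite normrN in h4.
    exists (- b), b; rewrite -/f in h1 h2; rewrite ?subr0 ?opprK ?add0r be in h1 h2.
    by apply/andP; split; lra.
  by exists h.
have [h hP] := choice onto.
pose inv (P : R3) := h P.1 P.2.
have invK P : height tau P.1.1 P.1.2 (inv P) = P.2 by have [_ ->] := hP P.1.
have inv_lip P P' : `|inv P - inv P'| <= ((2 + (M + L)) / e1) * taxicab P P'.
  wlog le : P P' / inv P <= inv P' => [wl|].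
    have [|/ltW] := leP (inv P) (inv P'); first exact: wl.
    move=> /wl; rewrite distrC /taxicab.
    by rewrite (distrC P'.1.1) (distrC P'.1.2) (distrC P'.2).
  rewrite mulrAC ler_pdivlMr // mulrC distrC ger0_norm ?subr_ge0 //.
  apply: (le_trans (height_slope P.1.1 P.1.2 ht le)).
  rewrite invK.
  have := height_lip (P.1.1, P.1.2, inv P') (P'.1.1, P'.1.2, inv P') ht.
  rewrite !heightE invK /taxicab /= subrr normr0 addr0 => h1.
  have h2 := ler_norm (height tau P.1.1 P.1.2 (inv P') - P'.2).
  have h3 := ler_norm (P'.2 - P.2); rewrite distrC in h3.
  have h4 : 0 <= (M + L) * `|P.2 - P'.2| by rewrite mulr_ge0 // addr_ge0.
  have h5 := normr_ge0 (P.1.1 - P'.1.1); have h6 := normr_ge0 (P.1.2 - P'.1.2).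
  have h7 := normr_ge0 (P.2 - P'.2).
  by lra.
have c11 : continuous (fun P : R3 => P.1.1).
  by do 2 apply: continuous_proj1; move=> P; exact: cvg_id.
have c12 : continuous (fun P : R3 => P.1.2).
  by apply: continuous_proj2; apply: continuous_proj1; move=> P; exact: cvg_id.
split.
  apply: continuous_pairing; first exact: continuous_pairing.
  exact: taxicab_lipschitz_continuous (fun P P' => height_lip P P' ht).
exists (fun P => (P.1.1, P.1.2, inv P)); split.
- apply: continuous_pairing; first exact: continuous_pairing.
  exact: taxicab_lipschitz_continuous inv_lip.
- move=> [[x y] z]; rewrite /inv /lift_heights /=; congr (_, _).
  by have [hK _] := hP (x, y); exact: hK.
- by move=> [[x y] z]; rewrite /lift_heights /=; congr (_, _); exact: invK.
Qed.

Lemma lift_heights_isotopy : ambient_isotopy lift_heights.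
Proof.
have cP1 : continuous (fun Q : R3 * R => Q.1) by move=> Q; exact: cvg_fst.
have ct : continuous (fun Q : R3 * R => Q.2) by move=> Q; exact: cvg_snd.
apply: isotopy_of_continuous; last exact: lift_heights_homeo.
  apply: continuous_pairing.
    by apply: continuous_pairing; [do 2 apply: continuous_proj1|
       apply: continuous_proj2; apply: continuous_proj1].
  move=> Q; rewrite /=; apply: cvgD; apply: cvgM.
  - by apply: cvgB; [exact: cvg_cst|exact: ct].
  - exact: (continuous_proj2 cP1).
  - exact: ct.
  - have ce := taxicab_lipschitz_continuous envelope_lipschitz.
    exact: (@continuous_comp _ _ _ (fun Q : R3 * R => Q.1) envelope Q (cP1 Q) (ce _)).
by move=> [[x y] z]; rewrite /lift_heights /= subr0 mul1r mul0r addr0.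
Qed.

End Extension.

(** The isotopy extension needed here: moving the heights of a curve and keeping its
    planar projection.  The hypothesis is that where two points of the projection are
    close, the height differences before and after have the same sign and comparable
    size, up to an error of the size of the planar distance. *)
Lemma vertical_isotopy (I : Type) (i0 : I) (p q z0 z1 : I -> R) (eps M L : R) :
  0 < eps -> eps <= M -> 0 <= L ->
  (forall i j, z0 j <= z0 i ->
    eps * (z0 i - z0 j) - L * (`|p i - p j| + `|q i - q j|) <= z1 i - z1 j <=
    M * (z0 i - z0 j) + L * (`|p i - p j| + `|q i - q j|)) ->
  exists2 H, ambient_isotopy H & forall i, H 1 (p i, q i, z0 i) = (p i, q i, z1 i).
Proof.
move=> eps0 epsM L0 sep.
exists (lift_heights p q z0 z1 eps M L).
  exact: (lift_heights_isotopy i0).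
move=> i; rewrite /lift_heights /= (envelope_interpolates i0) //.
by rewrite subrr mul0r add0r mul1r.
Qed.

End Vertical.

(** * Rotations and radial stretchings of space *)

Section PlaneMotions.
Context (R : realType).
Local Notation R3 := (R * R * R)%type.

Lemma continuous_coordinates :
  [/\ continuous (fun P : R3 => P.1.1), continuous (fun P : R3 => P.1.2) &
      continuous (fun P : R3 => P.2)].
Proof.
have c1 : continuous (fun P : R3 => P.1) by move=> P; exact: cvg_fst.
by split; [exact: continuous_proj1|exact: continuous_proj2|move=> P; exact: cvg_snd].
Qed.

Lemma continuous_space_time :
  [/\ continuous (fun Q : R3 * R => Q.1.1.1), continuous (fun Q : R3 * R => Q.1.1.2),
      continuous (fun Q : R3 * R => Q.1.2) & continuous (fun Q : R3 * R => Q.2)].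
Proof.
have c1 : continuous (fun Q : R3 * R => Q.1) by move=> P; exact: cvg_fst.
have c11 := continuous_proj1 c1.
by split; [exact: continuous_proj1|exact: continuous_proj2|exact: continuous_proj2|
  move=> P; exact: cvg_snd].
Qed.

Definition turn_z (w tau : R) (P : R3) : R3 :=
  (P.1.1 * cos (tau * w) - P.1.2 * sin (tau * w),
   P.1.1 * sin (tau * w) + P.1.2 * cos (tau * w), P.2).

Definition turn_x (w tau : R) (P : R3) : R3 :=
  (P.1.1, P.1.2 * cos (tau * w) - P.2 * sin (tau * w),
   P.1.2 * sin (tau * w) + P.2 * cos (tau * w)).

Lemma continuous_cos_time (w : R) : continuous (fun Q : R3 * R => cos (Q.2 * w)).
Proof.
have [_ _ _ ct] := continuous_space_time.
move=> Q; apply: (@continuous_comp _ _ _ (fun Q : R3 * R => Q.2 * w) cos).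
  by apply: cvgMr_tmp; exact: ct.
exact: continuous_cos.
Qed.

Lemma continuous_sin_time (w : R) : continuous (fun Q : R3 * R => sin (Q.2 * w)).
Proof.
have [_ _ _ ct] := continuous_space_time.
move=> Q; apply: (@continuous_comp _ _ _ (fun Q : R3 * R => Q.2 * w) sin).
  by apply: cvgMr_tmp; exact: ct.
exact: continuous_sin.
Qed.

Lemma rotation_cancel (a x y : R) :
  (x * cos a - y * sin a) * cos a + (x * sin a + y * cos a) * sin a = x /\
  (x * sin a + y * cos a) * cos a - (x * cos a - y * sin a) * sin a = y.
Proof.
have e := cos2Dsin2 a; split.
  by rewrite -[RHS]mulr1 -e; ring.
by rewrite -[RHS]mulr1 -e; ring.
Qed.

Lemma homeo_of_isotopy_inverse (H H' : R -> R3 -> R3) tau :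
  continuous (fun Q : R3 * R => H Q.2 Q.1) ->
  continuous (fun Q : R3 * R => H' Q.2 Q.1) ->
  cancel (H tau) (H' tau) -> cancel (H' tau) (H tau) -> homeomorphism (H tau).
Proof.
have slice F : continuous (fun Q : R3 * R => F Q.2 Q.1 : R3) -> continuous (F tau).
  move=> cF P; apply: (@continuous_comp _ _ _ (fun P : R3 => (P, tau)) (fun Q => F Q.2 Q.1)).
    by apply: (@continuous_pairing _ _ _ id (fun=> tau)) => ?; [exact: cvg_id|exact: cvg_cst].
  exact: cF.
by move=> cH cH' K K'; split; [exact: slice|exists (H' tau); split => //; exact: slice].
Qed.

Lemma continuous_turn_z w : continuous (fun Q : R3 * R => turn_z w Q.2 Q.1).
Proof.
have [cx cy cz ct] := continuous_space_time.
have cc := @continuous_cos_time w; have cs := @continuous_sin_time w.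
apply: continuous_pairing => //; apply: continuous_pairing => Q.
  by apply: cvgB; apply: cvgM; [exact: cx|exact: cc|exact: cy|exact: cs].
by apply: cvgD; apply: cvgM; [exact: cx|exact: cs|exact: cy|exact: cc].
Qed.

Lemma continuous_turn_x w : continuous (fun Q : R3 * R => turn_x w Q.2 Q.1).
Proof.
have [cx cy cz ct] := continuous_space_time.
have cc := @continuous_cos_time w; have cs := @continuous_sin_time w.
apply: continuous_pairing; first (apply: continuous_pairing => //).
  by move=> Q; apply: cvgB; apply: cvgM; [exact: cy|exact: cc|exact: cz|exact: cs].
by move=> Q; apply: cvgD; apply: cvgM; [exact: cy|exact: cs|exact: cz|exact: cc].
Qed.

Lemma turn_zK w tau : cancel (turn_z w tau) (turn_z (- w) tau).
Proof.
move=> [[x y] z]; rewrite /turn_z /= !mulrN cosN sinN.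
have [e1 e2] := rotation_cancel (tau * w) x y.
by congr (_, _, _); [rewrite -{3}e1; ring|rewrite -{3}e2; ring].
Qed.

Lemma turn_xK w tau : cancel (turn_x w tau) (turn_x (- w) tau).
Proof.
move=> [[x y] z]; rewrite /turn_x /= !mulrN cosN sinN.
have [e1 e2] := rotation_cancel (tau * w) y z.
by congr (_, _, _); [rewrite -{3}e1; ring|rewrite -{3}e2; ring].
Qed.

Lemma turn_z_isotopy w : ambient_isotopy (turn_z w).
Proof.
apply: isotopy_of_continuous; first exact: continuous_turn_z.
  by move=> [[x y] z]; rewrite /turn_z /= !mul0r cos0 sin0 !mulr1 !mulr0 subr0 add0r.
move=> tau _; apply: (@homeo_of_isotopy_inverse _ (turn_z (- w))).
- exact: continuous_turn_z.
- exact: continuous_turn_z.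
- exact: turn_zK.
- by move=> P; rewrite -{1}[w]opprK turn_zK.
Qed.

Lemma turn_x_isotopy w : ambient_isotopy (turn_x w).
Proof.
apply: isotopy_of_continuous; first exact: continuous_turn_x.
  by move=> [[x y] z]; rewrite /turn_x /= !mul0r cos0 sin0 !mulr1 !mulr0 subr0 add0r.
move=> tau _; apply: (@homeo_of_isotopy_inverse _ (turn_x (- w))).
- exact: continuous_turn_x.
- exact: continuous_turn_x.
- exact: turn_xK.
- by move=> P; rewrite -{1}[w]opprK turn_xK.
Qed.

Lemma turn_z_polar w (r a z : R) :
  turn_z w 1 (r * cos a, r * sin a, z) = (r * cos (a + w), r * sin (a + w), z).
Proof. by rewrite /turn_z /= mul1r cosD sinD; congr (_, _, _); ring. Qed.

(** A half turn about the first axis turns the reflection in the second coordinate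
    into the mirror image in the third. *)
Lemma turn_x_half (x y z : R) : turn_x pi 1 (x, y, z) = (x, - y, - z).
Proof. by rewrite /turn_x /= mul1r cospi sinpi; congr (_, _, _); ring. Qed.

Definition radius (P : R3) : R := Num.sqrt (P.1.1 ^+ 2 + P.1.2 ^+ 2).

Lemma radius_scale (a : R) P : 0 <= a ->
  radius (a * P.1.1, a * P.1.2, P.2) = a * radius P.
Proof.
move=> a0; rewrite /radius /= !exprMn -mulrDr sqrtrM ?exprn_ge0 //.
by rewrite sqrtr_sqr ger0_norm.
Qed.

Lemma radius_polar (r a z : R) : 0 <= r -> radius (r * cos a, r * sin a, z) = r.
Proof.
by move=> r0; rewrite /radius /= !exprMn -mulrDr cos2Dsin2 mulr1 sqrtr_sqr ger0_norm.
Qed.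

Lemma continuous_radius : continuous radius.
Proof.
have [cx cy cz] := continuous_coordinates.
move=> P; apply: (@continuous_comp _ _ _ (fun P : R3 => P.1.1 ^+ 2 + P.1.2 ^+ 2) Num.sqrt).
  by apply: cvgD; rewrite /=; apply: cvgM; [exact: cx|exact: cx|exact: cy|exact: cy].
exact: sqrt_continuous.
Qed.

Section Radial.
Variables (lam : R -> R) (c : R).
Hypotheses (lam_cont : continuous lam) (c0 : 0 < c) (c1 : c <= 1).
Hypothesis lam_ge : forall r, c <= lam r.
Hypothesis lam_incr : forall r r', 0 <= r -> r < r' -> r * lam r < r' * lam r'.

Let mu tau r := 1 - tau + tau * lam r.

(** Each ray from the vertical axis is mapped to itself by r -> r lam(r), reached from
    the identity by a straight path. *)
Definition stretch (tau : R) (P : R3) : R3 :=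
  (mu tau (radius P) * P.1.1, mu tau (radius P) * P.1.2, P.2).

Let mu_ge tau r : 0 <= tau <= 1 -> c <= mu tau r.
Proof.
move=> /andP[t0 t1]; rewrite /mu; have := ler_wpM2l t0 (lam_ge r).
have h : 0 <= 1 - tau by lra.
have := ler_wpM2l h c1; lra.
Qed.

Let mu_cont tau : continuous (mu tau).
Proof.
move=> r; apply: cvgD; first exact: cvg_cst.
by apply: cvgM; [exact: cvg_cst|exact: lam_cont].
Qed.

(** Extended to an odd function of r, so that it is a bijection of the whole line. *)
Let profile tau r := r * mu tau `|r|.

Let profile_incr tau : 0 <= tau <= 1 -> {homo profile tau : r r' / r < r'}.
Proof.
move=> ht.
have pos r r' : 0 <= r -> r < r' -> profile tau r < profile tau r'.
  move=> r0 rr'; have r'0 := le_lt_trans r0 rr'.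
  rewrite /profile /mu !ger0_norm ?(ltW r'0) //.
  have h := lam_incr r0 rr'; case/andP: ht => t0 t1.
  have [t1'|t1'] := ltP tau 1.
    have h1 := ler_wpM2l t0 (ltW h).
    have h2 : 0 < (1 - tau) * (r' - r) by rewrite mulr_gt0 ?subr_gt0.
    by lra.
  have -> : tau = 1 by apply/eqP; rewrite eq_le t1.
  by rewrite subrr !add0r !mul1r.
have odd r : profile tau (- r) = - profile tau r by rewrite /profile normrN mulNr.
move=> r r' rr'; have [r0|r0] := leP 0 r; first exact: pos.
have [r'0|r'0] := leP r' 0.
  by rewrite -[r]opprK -[r']opprK !(odd (- _)) ltrN2 pos ?oppr_ge0 ?ltrN2.
apply: (@lt_trans _ _ 0); rewrite /profile.
  by rewrite nmulr_rlt0 // (lt_le_trans c0) // mu_ge.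
by rewrite mulr_gt0 // (lt_le_trans c0) // mu_ge.
Qed.

Let profile_inverse tau : 0 <= tau <= 1 ->
  exists h, [/\ continuous h, {homo h : x y / x < y}, cancel (profile tau) h
                & cancel h (profile tau)].
Proof.
move=> ht; apply: increasing_inverse.
- move=> r; apply: cvgM; first exact: cvg_id.
  exact: (@continuous_comp R R R (fun r => `|r|) (mu tau) r (@norm_continuous _ _ r) (@mu_cont tau _)).
- exact: profile_incr.
- move=> y; exists (- (`|y| / c)), (`|y| / c).
  have b0 : 0 <= `|y| / c by rewrite divr_ge0 // ltW.
  rewrite /profile normrN (ger0_norm b0) mulNr -ler_norml.
  have := ler_wpM2l b0 (mu_ge (`|y| / c) ht).
  by rewrite divfK // gt_eqF.
Qed.

Lemma continuous_stretch : continuous (fun Q : R3 * R => stretch Q.2 Q.1).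
Proof.
have [cx cy cz ct] := continuous_space_time.
have cm : continuous (fun Q : R3 * R => mu Q.2 (radius Q.1)).
  move=> Q; apply: cvgD; first by apply: cvgB; [exact: cvg_cst|exact: ct].
  apply: cvgM; first exact: ct.
  apply: (@continuous_comp _ _ _ (fun Q : R3 * R => radius Q.1) lam); last exact: lam_cont.
  apply: (@continuous_comp _ _ _ (fun Q : R3 * R => Q.1) radius); last exact: continuous_radius.
  exact: cvg_fst.
apply: continuous_pairing => //; apply: continuous_pairing => Q.
  by apply: cvgM; [exact: cm|exact: cx].
by apply: cvgM; [exact: cm|exact: cy].
Qed.

(** The inverse divides by the scaling factor at the original radius, which is the
    inverse profile applied to the new radius; written this way it is continuous on
    the axis too. *)
Lemma stretch_isotopy : ambient_isotopy stretch.
Proof.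
apply: isotopy_of_continuous; first exact: continuous_stretch.
  by move=> [[x y] z]; rewrite /stretch /mu /= !mul0r subr0 addr0 !mul1r.
move=> tau ht.
have [h [ch hi hK hK']] := profile_inverse ht.
have mu_neq0 r : mu tau r != 0 by rewrite gt_eqF // (lt_le_trans c0) // mu_ge.
have mu_gt0 r : 0 < mu tau r by rewrite (lt_le_trans c0) // mu_ge.
have h_ge0 r : 0 <= r -> 0 <= h r.
  have hm : {mono h : a b / a <= b} by exact: le_mono.
  have h0 : h 0 = 0 by rewrite -{2}[0]hK /profile mul0r.
  by move=> r0; rewrite -h0 hm.
have [cx cy cz] := continuous_coordinates.
have r0 P : 0 <= radius P by exact: sqrtr_ge0.
pose nu (P : R3) := (mu tau (h (radius P)))^-1.
have cnu : continuous nu.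
  move=> P; apply: cvgV; first exact: mu_neq0.
  apply: (@continuous_comp _ _ _ (fun P => h (radius P)) (mu tau)); last exact: mu_cont.
  apply: (@continuous_comp _ _ _ radius h); last exact: ch.
  exact: continuous_radius.
split.
  move=> P; apply: (@continuous_comp _ _ _ (fun P : R3 => (P, tau)) (fun Q => stretch Q.2 Q.1)).
    by apply: (@continuous_pairing _ _ _ id (fun=> tau)) => ?; [exact: cvg_id|exact: cvg_cst].
  exact: continuous_stretch.
exists (fun P => (nu P * P.1.1, nu P * P.1.2, P.2)); split.
- apply: continuous_pairing => //; apply: continuous_pairing => P.
    by apply: cvgM; [exact: cnu|exact: cx].
  by apply: cvgM; [exact: cnu|exact: cy].
- move=> P; rewrite /nu (radius_scale P (ltW (mu_gt0 _))).
  have -> : mu tau (radius P) * radius P = profile tau (radius P).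
    by rewrite /profile ger0_norm // mulrC.
  rewrite hK /stretch /= !mulKf //; by case: P => [[]].
- move=> P; rewrite /stretch /=.
  have nu0 : 0 <= nu P by rewrite /nu invr_ge0 ltW.
  rewrite (radius_scale P nu0).
  have -> : nu P * radius P = h (radius P).
    rewrite -{1}[radius P]hK' /profile (ger0_norm (h_ge0 _ (r0 P))) /nu.
    by rewrite mulrC mulfK.
  by rewrite /nu !mulVKf //; case: (P) => [[]].
Qed.

Lemma stretch_polar (r a z : R) : 0 <= r ->
  stretch 1 (r * cos a, r * sin a, z) = (r * lam r * cos a, r * lam r * sin a, z).
Proof.
move=> r0; rewrite /stretch radius_polar // /mu subrr add0r mul1r /=.
by congr (_, _, _); ring.
Qed.

End Radial.

Lemma cos_sin_eq (a b : R) : cos a = cos b -> sin a = sin b ->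
  (a - b) / (2 * pi) \is a Num.int.
Proof.
move=> ec es; have pi0 := pi_gt0 R.
have e1 : cos (a - b) = 1 by rewrite cosB ec es -!expr2 cos2Dsin2.
have cosper : periodic1 (fun t : R => cos (2 * pi * t)).
  by move=> t; rewrite mulrDr mulr1 mulr_natl cosD2pi.
set d := (a - b) / (2 * pi) in e1 *.
have ed : a - b = 2 * pi * d by rewrite /d mulrC divfK // mulf_neq0 ?gt_eqF.
have /andP[f0 f1] := frac_itv d.
have e2 : cos (2 * pi * frac d) = 1 by rewrite (periodic_frac cosper) -ed.
have e3 : sin (pi * frac d) ^+ 2 = 0.
  move: e2; rewrite -mulrA mulr_natl cos_mulr2n cos2sin2; lra.
have {}e3 : sin (pi * frac d) = 0 by apply/eqP; rewrite -sqrf_eq0 e3.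
have [f0'|f0'] := eqVneq (frac d) 0.
  by rewrite -[d]subr0 -f0' fracB_int.
have : 0 < sin (pi * frac d).
  have f0'' : 0 < frac d by rewrite lt_neqAle eq_sym f0'.
  by rewrite sin_gt0_pi // mulr_gt0 //= -{2}[pi]mulr1 ltr_pM2l.
by rewrite e3 ltxx.
Qed.

End PlaneMotions.

(** * Uniform bounds on compacta; functions tangent to the identity *)

Section Separation.
Context (R : realType).

Lemma compact_uniform_bound (K : set (R * R)) (P : R -> R * R -> Prop) :
  compact K ->
  (forall p, K p -> exists k0 : R, \forall q \near p, forall k, k0 <= k -> P k q) ->
  exists k : R, 1 <= k /\ forall p, K p -> P k p.
Proof.
move=> /compact_near_coveringP cK loc.
have [|A oA AP] := cK nat \oo (fun N p => P N.+1%:R p) _ _.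
  move=> p /loc[k0 nk0].
  exists ([set q | forall k, k0 <= k -> P k q], [set N : nat | k0 <= N%:R]).
    by split => //=; exact: nbhs_infty_ger.
  by move=> [q N] /= [h kN]; apply: h; rewrite (le_trans kN) // ler_nat.
by exists A.+1%:R; split; [rewrite ler1n|apply: (AP A) => /=].
Qed.

Lemma segment_square_compact : compact (`[0 : R, 1] `*` `[0 : R, 1]).
Proof. by apply: compact_setX; exact: segment_compact. Qed.

(** Used for the sine, to bound planar distances from below, and for the tangent, to
    compare chord and arc. *)
Lemma unit_derivative_at0 (f : R -> R) : is_derive (0 : R) (1 : R) f (1 : R) -> f 0 = 0 ->
  forall e, 0 < e -> exists2 d, 0 < d & forall z, `|z| < d -> `|f z - z| <= e * `|z|.
Proof.
move=> /is_derive1_caratheodory[h [fh ch h0]] f0 e e0.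
move/cvgrPdist_lt/(_ _ e0): ch => /nbhs_ballP[d d0 hd]; exists d => // z zd.
have := fh z; rewrite f0 !subr0 => ->.
have -> : h z * z - z = - ((h 0 - h z) * z) by rewrite h0; ring.
rewrite normrN normrM ler_wpM2r // ltW //; apply: hd.
by rewrite /ball /= sub0r normrN.
Qed.

Lemma sin_small : exists2 d : R, 0 < d & forall z, `|z| < d -> `|z| <= 2 * `|sin z|.
Proof.
have hs : is_derive (0 : R) (1 : R) sin (1 : R) by have := is_derive_sin (0 : R); rewrite cos0.
have [|d d0 hd] := unit_derivative_at0 hs (sin0 R) (e := 2^-1); first by rewrite invr_gt0.
exists d => // z /hd; rewrite distrC => h.
by have := ler_normD (z - sin z) (sin z); rewrite subrK; lra.
Qed.

End Separation.

(** * Curves over the billiard projection and their crossings *)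

Section Curves.
Context (R : realType) (s n m : nat).
Hypotheses (s0 : (0 < s)%N) (n0 : (0 < n)%N) (m0 : (0 < m)%N).
Hypotheses (sn : coprime s n) (sm : coprime s m).
Local Notation R3 := (R * R * R)%type.
Implicit Types (x y phi : R) (w : R -> R).

(** The planar projection (annulus_x, annulus_y) has angle 2 pi s x and radius
    1 + g(nx); it is the projection of T(s, n, m, phi) and, after the radial stretch
    and a change of parameter, also that of the curve in a slice. *)
Definition annulus_x x : R := (1 + g (n%:R * x)) * cos (2 * pi * (s%:R * x)).
Definition annulus_y x : R := (1 + g (n%:R * x)) * sin (2 * pi * (s%:R * x)).
Definition level w phi x : R := g (m%:R * w x + phi).

Definition torus_curve w phi x : R3 := (annulus_x x, annulus_y x, level w phi x).

(** The reparametrizations under which crossings are controlled: compatibility with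
    the shift by 1/n and with the reflection keeps w(x) + w(y) = x + y at double
    points, and the bound keeps m(w(x) - w(y)) away from the integers. *)
Definition tame w : Prop :=
  [/\ exists2 C, 0 < C & forall x y, `|x - y| <= 1 -> `|w x - w y| <= C * `|x - y|,
      forall x, w (x + n%:R^-1) = w x + n%:R^-1,
      forall x, w (- x) = - w x &
      forall x, `|w x - x| < (2 * m%:R * s%:R)^-1].

(** The phases at which some crossing degenerates.  With d = gcd(n, m) they are the
    multiples of d/(2n); for s = 1 the projection has no double points. *)
Definition singular phi : Prop :=
  (1 < s)%N /\ 2 * phi * (n %/ gcdn n m)%:R \is a Num.int.

Let sR : 0 < s%:R :> R. Proof. by rewrite ltr0n. Qed.
Let nR : 0 < n%:R :> R. Proof. by rewrite ltr0n. Qed.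
Let mR : 0 < m%:R :> R. Proof. by rewrite ltr0n. Qed.

Lemma tame_id : tame id.
Proof.
split=> //; first by exists 1 => // x y _; rewrite mul1r.
by move=> x; rewrite subrr normr0 invr_gt0 !mulr_gt0.
Qed.

Lemma tame_convex w w' tau : 0 <= tau <= 1 -> tame w -> tame w' ->
  tame (fun x => (1 - tau) * w x + tau * w' x).
Proof.
move=> /andP[t0 t1] [[C C0 lw] w1 wN wb] [[C' C'0 lw'] w1' wN' wb'].
have t1' : 0 <= 1 - tau by lra.
have comb a b : `|(1 - tau) * a + tau * b| <= (1 - tau) * `|a| + tau * `|b|.
  by rewrite (le_trans (ler_normD _ _)) // !normrM (ger0_norm t0) (ger0_norm t1').
split.
- exists (C + C'); first by rewrite addr_gt0.
  move=> x y xy.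
  have -> : (1 - tau) * w x + tau * w' x - ((1 - tau) * w y + tau * w' y) =
    (1 - tau) * (w x - w y) + tau * (w' x - w' y) by ring.
  apply: (le_trans (comb _ _)).
  have h1 := lw _ _ xy; have h2 := lw' _ _ xy.
  have h3 : (1 - tau) * `|w x - w y| <= 1 * `|w x - w y| by rewrite ler_wpM2r //; lra.
  have h4 : tau * `|w' x - w' y| <= 1 * `|w' x - w' y| by rewrite ler_wpM2r.
  by lra.
- by move=> x; rewrite w1 w1'; ring.
- by move=> x; rewrite wN wN'; ring.
- move=> x.
  have -> : (1 - tau) * w x + tau * w' x - x =
    (1 - tau) * (w x - x) + tau * (w' x - x) by ring.
  apply: (le_lt_trans (comb _ _)); have := wb x; have := wb' x.
  set b := _^-1; have [->|t0'] := eqVneq tau 0; first by rewrite subr0; lra.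
  have t0'' : 0 < tau by rewrite lt_neqAle eq_sym t0'.
  move=> h1 h2; have := ltr_pM2l t0'' `|w' x - x| b; rewrite h1 => h3.
  have h4 := ler_wpM2l t1' (ltW h2).
  by lra.
Qed.

Lemma tame_continuous w : tame w -> continuous w.
Proof. by move=> [[C _ h] _ _ _]; exact: locally_lipschitz_continuous h. Qed.

Lemma tame_shift w : tame w -> forall x y, n%:R * (x - y) \is a Num.int ->
  w x - w y = x - y.
Proof.
move=> [_ w1 _ _] x y xy.
have p1 : periodic1 (fun t => w (t / n%:R) - t / n%:R).
  by move=> t; rewrite mulrDl mul1r w1; ring.
have := periodic_int p1 (x := n%:R * x) (y := n%:R * y).
rewrite -mulrBr => /(_ xy); rewrite ![n%:R * _]mulrC !mulfK ?gt_eqF //; lra.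
Qed.

(** At a double point the sum of the two parameters is preserved: this is why the
    singular phases are the same for the solid torus and for all slices. *)
Lemma tame_reflect w : tame w -> forall x y, n%:R * (x + y) \is a Num.int ->
  w x + w y = x + y.
Proof.
move=> tw x y xy; have [_ _ wN _] := tw.
by have := tame_shift tw (x := x) (y := - y); rewrite wN !opprK; apply.
Qed.

Lemma tame_D1 w : tame w -> forall x, w (x + 1) = w x + 1.
Proof.
move=> tw x; have := tame_shift tw (x := x + 1) (y := x).
by rewrite addrAC subrr add0r mulr1 -[n%:R]/(n%:Z%:~R) intr_int => /(_ isT); lra.
Qed.

Lemma coprime_int (a b : nat) (t : R) : (0 < a)%N -> coprime a b ->
  a%:R * t \is a Num.int -> b%:R * t \is a Num.int -> t \is a Num.int.
Proof.
move=> a0 /eqP ab at_ bt; case: (egcdnP b a0) => u v e _.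
rewrite ab in e.
have -> : t = u%:R * (a%:R * t) - v%:R * (b%:R * t).
  by rewrite !mulrA -!natrM e natrD; ring.
by rewrite rpredB // rpredM // -?[_%:R]/(_%:Z%:~R) ?intr_int.
Qed.

Lemma natr_int (k : nat) : k%:R \is a @Num.int R.
Proof. by rewrite -[_%:R]/(_%:Z%:~R) intr_int. Qed.

Lemma annulus_radius x : annulus_x x ^+ 2 + annulus_y x ^+ 2 = (1 + g (n%:R * x)) ^+ 2.
Proof. by rewrite /annulus_x /annulus_y !exprMn -mulrDr cos2Dsin2 mulr1. Qed.

(** Equal angles give that s(x - y) is an integer, and equal radii give that n(x - y)
    or n(x + y) is one; in the first case coprimality makes x - y an integer. *)
Lemma double_point x y : annulus_x x = annulus_x y -> annulus_y x = annulus_y y ->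
  s%:R * (x - y) \is a Num.int /\ (x - y \is a Num.int \/ n%:R * (x + y) \is a Num.int).
Proof.
move=> ex ey.
have /andP[gx _] := g_itv (n%:R * x); have /andP[gy _] := g_itv (n%:R * y).
have eg : g (n%:R * x) = g (n%:R * y).
  have := annulus_radius x; rewrite ex ey annulus_radius => /eqP.
  by rewrite eqrXn2 ?addr_ge0 // => /eqP; lra.
have r0 : 1 + g (n%:R * y) != 0 by rewrite gt_eqF // ltr_pwDl.
have sxy : s%:R * (x - y) \is a Num.int.
  move: ex ey; rewrite /annulus_x /annulus_y eg => /(mulfI r0) ec /(mulfI r0) es.
  have := cos_sin_eq ec es; rewrite -mulrBr mulrC mulKf -?mulrBr //.
  by rewrite mulf_neq0 // gt_eqF // pi_gt0.
split=> //; have [|] := g_eq eg; rewrite -?mulrBr -?mulrDr; last by right.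
by left; exact: coprime_int sn _ _.
Qed.

(** If the heights agree, then m(w(x) - w(y)) or m(w(x) + w(y)) + 2 phi is an integer.
    The first is within 1/s of m(x - y), which lies in (1/s)Z, so the two are equal and
    coprimality of s and m forces x - y to be an integer.  The second makes the phase
    singular. *)
Lemma levels_differ w phi x y : tame w -> ~ singular phi ->
  s%:R * (x - y) \is a Num.int -> n%:R * (x + y) \is a Num.int ->
  x - y \isn't a Num.int -> level w phi x != level w phi y.
Proof.
move=> tw nphi sxy nxy xy; apply/eqP => /g_eq[].
  have -> : m%:R * w x + phi - (m%:R * w y + phi) = m%:R * (w x - w y) by ring.
  move=> h; have [_ _ _ wb] := tw.
  (* An integer, and small because w is close to the identity. *)
  pose e := s%:R * (m%:R * (w x - w y)) - m%:R * (s%:R * (x - y)).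
  have ie : e \is a Num.int by rewrite rpredB // rpredM // natr_int.
  have /(int_lt1 ie) e0 : `|e| < 1.
    have -> : e = s%:R * m%:R * ((w x - x) - (w y - y)) by rewrite /e; ring.
    rewrite normrM ger0_norm ?mulr_ge0 // -ltr_pdivlMl ?mulr_gt0 // mulr1.
    apply: (le_lt_trans (ler_normB _ _)).
    have -> : (s%:R * m%:R)^-1 = (2 * m%:R * s%:R)^-1 + (2 * m%:R * s%:R)^-1 :> R.
      by field; rewrite !gt_eqF.
    by rewrite ltrD.
  have mxy : m%:R * (x - y) \is a Num.int.
    have -> : m%:R * (x - y) = m%:R * (w x - w y).
      apply: (mulfI (lt0r_neq0 sR)); rewrite mulrCA.
      by apply/eqP; rewrite eq_sym -subr_eq0 -/e e0.
    exact: h.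
  by move: xy; rewrite (coprime_int s0 sm sxy mxy).
have -> : m%:R * w x + phi + (m%:R * w y + phi) = m%:R * (w x + w y) + 2 * phi by ring.
rewrite (tame_reflect tw nxy) => h; apply: nphi; split.
  rewrite ltnNge; apply/negP => s1; move: xy; have /eqP s1' : s == 1%N by rewrite eqn_leq s1.
  by move: sxy; rewrite s1' mul1r => ->.
set d := gcdn n m; set N := (n %/ d)%N.
have eN : (N * d)%N = n by rewrite divnK // dvdn_gcdl.
have em : (m %/ d * d)%N = m by rewrite divnK // dvdn_gcdr.
have -> : 2 * phi * N%:R = N%:R * (m%:R * (x + y) + 2 * phi) - (m %/ d)%:R * (n%:R * (x + y)).
  by rewrite -eN -{1}em !natrM; ring.
by rewrite rpredB // rpredM // natr_int.
Qed.

Lemma continuous_level w phi : continuous w -> continuous (level w phi).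
Proof.
move=> cw x; apply: (@continuous_comp _ _ _ (fun x => m%:R * w x + phi) (@g R)).
  apply: cvgD; last exact: cvg_cst.
  by apply: cvgM; [exact: cvg_cst|exact: cw].
exact: continuous_g.
Qed.

(** A crossing cannot change along a path of nonsingular data, by the intermediate
    value theorem. *)
Lemma levels_same_order w w' phi phi' x y : tame w -> tame w' ->
  (forall tau, 0 <= tau <= 1 -> ~ singular ((1 - tau) * phi + tau * phi')) ->
  s%:R * (x - y) \is a Num.int -> n%:R * (x + y) \is a Num.int ->
  x - y \isn't a Num.int -> level w phi y < level w phi x ->
  level w' phi' y < level w' phi' x.
Proof.
move=> tw tw' nsing sxy nxy xy lt0.
pose W tau x := (1 - tau) * w x + tau * w' x.
pose Phi tau := (1 - tau) * phi + tau * phi'.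
pose f tau := level (W tau) (Phi tau) x - level (W tau) (Phi tau) y.
have cl z : continuous (fun tau => level (W tau) (Phi tau) z).
  move=> tau.
  apply: (@continuous_comp _ _ _ (fun tau => m%:R * W tau z + Phi tau) (@g R)); last exact: continuous_g.
  have lin a b : (fun t : R => (1 - t) * a + t * b) t @[t --> tau] --> (1 - tau) * a + tau * b.
    apply: cvgD; apply: cvgM; [|exact: cvg_cst|exact: cvg_id|exact: cvg_cst].
    by apply: cvgB; [exact: cvg_cst|exact: cvg_id].
  by apply: cvgD; [apply: cvgM; [exact: cvg_cst|exact: lin]|exact: lin].
have cf : continuous f by move=> tau; apply: cvgB; exact: cl.
have E0 z : level (W 0) (Phi 0) z = level w phi z.
  by rewrite /level /W /Phi !subr0 !mul1r !mul0r !addr0.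
have E1 z : level (W 1) (Phi 1) z = level w' phi' z.
  by rewrite /level /W /Phi !subrr !mul1r !mul0r !add0r.
rewrite ltNge; apply/negP => le1.
have f0 : 0 < f 0 by rewrite /f !E0 subr_gt0.
have f1 : f 1 <= 0 by rewrite /f !E1 subr_le0.
have [||c c01 fc] := @IVT R f 0 1 0 ler01.
- exact: continuous_subspaceT.
- by have f10 := le_trans f1 (ltW f0); rewrite (min_r f10) (max_l f10) f1 ltW.
rewrite in_itv /= in c01.
have := levels_differ (tame_convex c01 tw tw') (nsing c c01) sxy nxy xy.
by move=> /eqP; apply; apply/eqP; rewrite -subr_eq0 -[_ - _]/(f c) fc.
Qed.

End Curves.

(** * Isotopy of curves with the same crossings *)

Section CurveIsotopy.
Context (R : realType) (s n m : nat).
Hypotheses (s0 : (0 < s)%N) (n0 : (0 < n)%N) (m0 : (0 < m)%N).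
Hypotheses (sn : coprime s n) (sm : coprime s m).
Local Notation R3 := (R * R * R)%type.
Local Notation X := (@annulus_x R s n).
Local Notation Y := (@annulus_y R s n).
Local Notation level := (@level R m).
Local Notation tame := (@tame R s n m).
Local Notation singular := (@singular R s n m).
Local Notation curve := (@torus_curve R s n m).
Implicit Types (x y phi : R) (w : R -> R).

Let sR : 0 < s%:R :> R. Proof. by rewrite ltr0n. Qed.
Let nR : 0 < n%:R :> R. Proof. by rewrite ltr0n. Qed.
Let mR : 0 < m%:R :> R. Proof. by rewrite ltr0n. Qed.

Lemma cos_turn_int x y : x - y \is a Num.int -> cos (2 * pi * x) = cos (2 * pi * y).
Proof.
have p1 : periodic1 (fun t : R => cos (2 * pi * t)).
  by move=> t; rewrite mulrDr mulr1 mulr_natl cosD2pi.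
exact: periodic_int p1 _ _.
Qed.

Lemma sin_turn_int x y : x - y \is a Num.int -> sin (2 * pi * x) = sin (2 * pi * y).
Proof.
have p1 : periodic1 (fun t : R => sin (2 * pi * t)).
  by move=> t; rewrite mulrDr mulr1 mulr_natl sinD2pi.
exact: periodic_int p1 _ _.
Qed.

Lemma annulus_x_D1 : periodic1 X.
Proof.
move=> x; rewrite /annulus_x.
rewrite (@g_int _ (n%:R * (x + 1)) (n%:R * x)); last first.
  by rewrite -mulrBr addrAC subrr add0r mulr1 natr_int.
rewrite (@cos_turn_int (s%:R * (x + 1)) (s%:R * x)) //.
by rewrite -mulrBr addrAC subrr add0r mulr1 natr_int.
Qed.

Lemma annulus_y_D1 : periodic1 Y.
Proof.
move=> x; rewrite /annulus_y.
rewrite (@g_int _ (n%:R * (x + 1)) (n%:R * x)); last first.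
  by rewrite -mulrBr addrAC subrr add0r mulr1 natr_int.
rewrite (@sin_turn_int (s%:R * (x + 1)) (s%:R * x)) //.
by rewrite -mulrBr addrAC subrr add0r mulr1 natr_int.
Qed.

Lemma level_D1 w phi : tame w -> periodic1 (level w phi).
Proof.
move=> tw x; apply: g_int; rewrite (tame_D1 n0 tw).
by have -> : m%:R * (w x + 1) + phi - (m%:R * w x + phi) = m%:R by ring.
Qed.

Lemma torus_curve_D1 w phi : tame w -> periodic1 (curve w phi).
Proof.
by move=> tw x; rewrite /torus_curve annulus_x_D1 annulus_y_D1 level_D1.
Qed.

Lemma continuous_scaled_g (k : nat) : continuous (fun x : R => g (k%:R * x)).
Proof.
move=> x; apply: (@continuous_comp _ _ _ (fun x => k%:R * x) (@g R)).
  by apply: cvgM; [exact: cvg_cst|exact: cvg_id].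
exact: continuous_g.
Qed.

Lemma continuous_annulus_x : continuous X.
Proof.
move=> x; apply: cvgM.
  by apply: cvgD; [exact: cvg_cst|exact: continuous_scaled_g].
apply: (@continuous_comp _ _ _ (fun x => 2 * pi * (s%:R * x)) (@cos R)).
  by do 2 (apply: cvgM; first exact: cvg_cst); exact: cvg_id.
exact: continuous_cos.
Qed.

Lemma continuous_annulus_y : continuous Y.
Proof.
move=> x; apply: cvgM.
  by apply: cvgD; [exact: cvg_cst|exact: continuous_scaled_g].
apply: (@continuous_comp _ _ _ (fun x => 2 * pi * (s%:R * x)) (@sin R)).
  by do 2 (apply: cvgM; first exact: cvg_cst); exact: cvg_id.
exact: continuous_sin.
Qed.

Lemma continuous_torus_curve w phi : tame w -> continuous (curve w phi).
Proof.
move=> tw; apply: continuous_pairing.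
  by apply: continuous_pairing; [exact: continuous_annulus_x|exact: continuous_annulus_y].
by apply: continuous_level; exact: tame_continuous tw.
Qed.

Definition shadow_dist x y : R := `|X x - X y| + `|Y x - Y y|.

Lemma shadow_dist_ge0 x y : 0 <= shadow_dist x y.
Proof. by rewrite addr_ge0. Qed.

(** The left side is at most the area of the parallelogram spanned by the two points
    of the plane, whose radii are between 1 and 2; this area is bounded by one radius
    times the distance of the points. *)
Lemma shadow_dist_lower x y :
  `|sin (2 * pi * s%:R * (x - y))| <= 2 * shadow_dist x y.
Proof.
have cross : (1 + g (n%:R * x)) * (1 + g (n%:R * y)) * sin (2 * pi * s%:R * (x - y))
    = Y x * (X y - X x) - X x * (Y y - Y x).
  have -> : 2 * pi * s%:R * (x - y) = 2 * pi * (s%:R * x) - 2 * pi * (s%:R * y) by ring.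
  by rewrite sinB /annulus_x /annulus_y; ring.
have /andP[gx0 gx1] := g_itv (n%:R * x); have /andP[gy0 gy1] := g_itv (n%:R * y).
have hx : `|X x| <= 2.
  rewrite /annulus_x normrM ger0_norm ?addr_ge0 // -[leRHS]mulr1.
  by apply: ler_pM => //; [rewrite addr_ge0|lra|exact: cos_max].
have hy : `|Y x| <= 2.
  rewrite /annulus_y normrM ger0_norm ?addr_ge0 // -[leRHS]mulr1.
  by apply: ler_pM => //; [rewrite addr_ge0|lra|exact: sin_max].
set S := sin _ in cross *.
have h1 : `|S| <= `|(1 + g (n%:R * x)) * (1 + g (n%:R * y)) * S|.
  rewrite normrM ler_peMl // ger0_norm ?mulr_ge0 ?addr_ge0 //.
  by rewrite -[leLHS]mulr1 ler_pM // lerDl.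
apply: (le_trans h1); rewrite cross /shadow_dist (distrC (X x)) (distrC (Y x)).
apply: (le_trans (ler_normB _ _)); rewrite (normrM (Y x)) (normrM (X x)).
have hA := ler_wpM2r (normr_ge0 (X y - X x)) hy.
have hB := ler_wpM2r (normr_ge0 (Y y - Y x)) hx.
by lra.
Qed.

(** The projection is locally injective with a Lipschitz inverse. *)
Lemma shadow_dist_local : exists2 d : R, 0 < d &
  forall x y, `|x - y| < d -> `|x - y| <= 4 * shadow_dist x y.
Proof.
have [e e0 he] := sin_small R.
have pi0 := pi_gt0 R; have pi2 : 2 <= pi :> R by exact: pi_ge2.
have K1 : 1 <= 2 * pi * s%:R :> R.
  have : (1 : R) * 1 <= (2 * pi) * s%:R by rewrite ler_pM ?ler1n //; lra.
  by rewrite mul1r.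
have K0 : 0 < 2 * pi * s%:R :> R by rewrite (lt_le_trans ltr01).
exists (e / (2 * pi * s%:R)); first by rewrite divr_gt0.
move=> x y; rewrite ltr_pdivlMr // => xy.
have := he (2 * pi * s%:R * (x - y)); rewrite normrM (gtr0_norm K0) mulrC => /(_ xy).
have := shadow_dist_lower x y.
have : 1 * `|x - y| <= 2 * pi * s%:R * `|x - y| by rewrite ler_wpM2r.
by rewrite [`|x - y| * _]mulrC; lra.
Qed.

Lemma level_lipschitz_shadow w phi : tame w -> exists d B : R, [/\ 0 < d, 0 <= B &
  forall x y, `|x - y| < d -> `|level w phi x - level w phi y| <= B * shadow_dist x y].
Proof.
move=> [[C C0 lw] _ _ _]; have [e e0 he] := shadow_dist_local.
have K0 : 0 < m%:R * C by rewrite mulr_gt0.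
exists (Num.min e (Num.min 1 (m%:R * C)^-1)), (8 * (m%:R * C)); split.
- by rewrite !lt_min e0 ltr01 invr_gt0.
- by rewrite mulr_ge0 // ltW.
move=> x y; rewrite !lt_min => /and3P[xe x1 xK].
have h1 := he _ _ xe.
have h2 : `|m%:R * w x + phi - (m%:R * w y + phi)| <= m%:R * C * `|x - y|.
  have -> : m%:R * w x + phi - (m%:R * w y + phi) = m%:R * (w x - w y) by ring.
  by rewrite normrM ger0_norm ?ler0n // -mulrA ler_wpM2l ?ler0n // lw // ltW.
have h3 : m%:R * C * `|x - y| <= 1.
  by rewrite -ler_pdivlMl // mulr1 ltW.
apply: (le_trans (g_lipschitz (le_trans h2 h3))).
have := ler_wpM2l (ltW K0) h1; lra.
Qed.

Lemma level_itv w phi x : 0 <= level w phi x <= 1.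
Proof. exact: g_itv. Qed.

Lemma continuous_diff (f : R -> R) : continuous f -> continuous (fun q : R * R => f q.1 - f q.2).
Proof.
move=> cf q; apply: cvgB.
  by apply: (@continuous_comp _ _ _ fst f); [exact: cvg_fst|exact: cf].
by apply: (@continuous_comp _ _ _ snd f); [exact: cvg_snd|exact: cf].
Qed.

Lemma continuous_shadow_dist : continuous (fun q : R * R => shadow_dist q.1 q.2).
Proof.
move=> q; apply: cvgD; apply: cvg_norm.
  exact: continuous_diff continuous_annulus_x _.
exact: continuous_diff continuous_annulus_y _.
Qed.

Section Two.
Variables (w w' : R -> R) (phi phi' : R).
Hypotheses (tw : tame w) (tw' : tame w').
Hypothesis nonsing :
  forall tau, 0 <= tau <= 1 -> ~ singular ((1 - tau) * phi + tau * phi').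

Let z0 := level w phi.
Let z1 := level w' phi'.

Let separated (k : R) (q : R * R) := z0 q.2 <= z0 q.1 ->
  k^-1 * (z0 q.1 - z0 q.2) - k * shadow_dist q.1 q.2 <= z1 q.1 - z1 q.2 <=
  k * (z0 q.1 - z0 q.2) + k * shadow_dist q.1 q.2.

Let bounds (q : R * R) : [/\ z0 q.1 - z0 q.2 <= 1, -1 <= z1 q.1 - z1 q.2 & z1 q.1 - z1 q.2 <= 1].
Proof.
have := level_itv w phi q.1; have := level_itv w phi q.2.
have := level_itv w' phi' q.1; have := level_itv w' phi' q.2.
by rewrite -/z0 -/z1; split; lra.
Qed.

Let shrink (k a : R) : 1 <= k -> 0 <= a -> k^-1 * a <= a.
Proof.
move=> k1 a0; have k0 : 0 < k by rewrite (lt_le_trans ltr01).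
by rewrite -[leRHS]mul1r ler_wpM2r // invf_le1.
Qed.

(** Far apart in the plane: the planar error term dominates bounded heights. *)
Let separated_far (p : R * R) : 0 < shadow_dist p.1 p.2 ->
  exists k0 : R, \forall q \near p, forall k, k0 <= k -> separated k q.
Proof.
(* For k beyond this bound the planar term is at least 2 near p, while heights
   lie in [0, 1]. *)
set D := shadow_dist _ _ => D0; exists (1 + 4 / D).
have : \forall q \near p, D / 2 < shadow_dist q.1 q.2.
  by apply: (cvgr_gt _ (@continuous_shadow_dist p)); rewrite -/D; lra.
apply: filterS => q hq k hk z0le.
have [b1 b2 b3] := bounds q.
have D4 : 0 < 4 / D by rewrite divr_gt0.
have k1 : 1 <= k by lra.
have z00 : 0 <= z0 q.1 - z0 q.2 by rewrite subr_ge0.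
have h1 := shrink k1 z00.
have h2 : 2 <= k * shadow_dist q.1 q.2.
  have -> : 2 = (4 / D) * (D / 2) :> R by field; rewrite gt_eqF.
  by apply: ler_pM; lra.
have h3 : 0 <= k * (z0 q.1 - z0 q.2) by rewrite mulr_ge0 //; lra.
by apply/andP; split; lra.
Qed.

(** Near the diagonal: heights are Lipschitz functions of the planar position. *)
Let separated_near (p : R * R) : p.1 - p.2 \is a Num.int ->
  exists k0 : R, \forall q \near p, forall k, k0 <= k -> separated k q.
Proof.
move=> pint.
have [d [B [d0 B0 hB]]] := level_lipschitz_shadow phi tw.
have [d' [B' [d'0 B'0 hB']]] := level_lipschitz_shadow phi' tw'.
exists (1 + B + B').
have ci : continuous (@id R) by move=> x; exact: cvg_id.
have /cvgrPdist_lt cd := @continuous_diff id ci p.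
have : \forall q \near p, `|p.1 - p.2 - (q.1 - q.2)| < Num.min d d'.
  by apply: cd; rewrite lt_min d0.
apply: filterS => q; rewrite lt_min distrC => /andP[qd qd'] k hk z0le.
set j := p.1 - p.2 in pint qd qd'.
have qj : q.2 - (q.2 + j) \is a Num.int by rewrite opprD addNKr rpredN.
have eD : shadow_dist q.1 (q.2 + j) = shadow_dist q.1 q.2.
  by rewrite /shadow_dist (periodic_int annulus_x_D1 qj) (periodic_int annulus_y_D1 qj).
have h0 : `|z0 q.1 - z0 q.2| <= B * shadow_dist q.1 q.2.
  rewrite -eD /z0 (periodic_int (level_D1 phi tw) qj); apply: hB.
  by have -> : q.1 - (q.2 + j) = q.1 - q.2 - j by ring.
have h1 : `|z1 q.1 - z1 q.2| <= B' * shadow_dist q.1 q.2.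
  rewrite -eD /z1 (periodic_int (level_D1 phi' tw') qj); apply: hB'.
  by have -> : q.1 - (q.2 + j) = q.1 - q.2 - j by ring.
have k1 : 1 <= k by lra.
have z00 : 0 <= z0 q.1 - z0 q.2 by rewrite subr_ge0.
have h2 := shrink k1 z00.
have D0 := shadow_dist_ge0 q.1 q.2.
have h3 : (B + B') * shadow_dist q.1 q.2 <= k * shadow_dist q.1 q.2.
  by rewrite ler_wpM2r //; lra.
have h4 : 0 <= k * (z0 q.1 - z0 q.2) by rewrite mulr_ge0 //; lra.
have h5 : 0 <= B * shadow_dist q.1 q.2 by rewrite mulr_ge0.
rewrite ger0_norm // in h0; move: h1; rewrite ler_norml => /andP[h1 h1'].
by apply/andP; split; lra.
Qed.

(** Near a crossing: both height differences keep their common sign. *)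
Let separated_crossing (p : R * R) : shadow_dist p.1 p.2 = 0 -> p.1 - p.2 \isn't a Num.int ->
  exists k0 : R, \forall q \near p, forall k, k0 <= k -> separated k q.
Proof.
move=> D0 pint.
have [eX eY] : X p.1 = X p.2 /\ Y p.1 = Y p.2.
  move/eqP: D0; rewrite paddr_eq0 // !normr_eq0 !subr_eq0.
  by move=> /andP[/eqP ? /eqP ?].
have [sp [np|np]] := double_point s0 sn eX eY; first by rewrite np in pint.
have cz0 := @continuous_diff _ (continuous_level (m := m) (phi := phi) (tame_continuous tw)) p.
have cz1 := @continuous_diff _ (continuous_level (m := m) (phi := phi') (tame_continuous tw')) p.
have ns0 : ~ singular phi.
  by have := nonsing (tau := 0); rewrite subr0 mul1r mul0r addr0; apply; rewrite lexx ler01.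
have := levels_differ s0 n0 m0 sm tw ns0 sp np pint.
rewrite -/z0 neq_lt => /orP[lt0|gt0].
  exists 0; have : \forall q \near p, z0 q.1 - z0 q.2 < 0.
    by apply: (cvgr_lt _ cz0); rewrite subr_lt0.
  by apply: filterS => q; rewrite subr_lt0 => qlt k _; rewrite /separated leNgt qlt.
have gt1 : z1 p.2 < z1 p.1 by exact: (levels_same_order s0 n0 m0 sm tw tw' nonsing sp np pint gt0).
set e0 := z0 p.1 - z0 p.2; set e1 := z1 p.1 - z1 p.2.
have e00 : 0 < e0 by rewrite subr_gt0.
have e10 : 0 < e1 by rewrite subr_gt0.
(* For k beyond this bound, k times either height difference is at least 1 near
   the crossing. *)
exists (1 + 2 / e0 + 2 / e1).
have n0' : \forall q \near p, e0 / 2 < z0 q.1 - z0 q.2.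
  by apply: (cvgr_gt _ cz0); rewrite -/z0 -/e0; lra.
have n1' : \forall q \near p, e1 / 2 < z1 q.1 - z1 q.2.
  by apply: (cvgr_gt _ cz1); rewrite -/z1 -/e1; lra.
apply: filterS2 n0' n1' => q q0 q1 k hk z0le.
have [b1 b2 b3] := bounds q.
have r0 : 0 < 2 / e0 by rewrite divr_gt0.
have r1 : 0 < 2 / e1 by rewrite divr_gt0.
have k0 : 0 < k by lra.
have h1 : 1 <= k * (z0 q.1 - z0 q.2).
  have -> : 1 = (2 / e0) * (e0 / 2) :> R by field; rewrite gt_eqF.
  by apply: ler_pM; lra.
have h2 : k^-1 * (z0 q.1 - z0 q.2) <= z1 q.1 - z1 q.2.
  rewrite ler_pdivrMl //; apply: (le_trans b1).
  have -> : 1 = (2 / e1) * (e1 / 2) :> R by field; rewrite gt_eqF.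
  by apply: ler_pM; lra.
have h3 : 0 <= k * shadow_dist q.1 q.2 by rewrite mulr_ge0 ?shadow_dist_ge0 // ltW.
by apply/andP; split; lra.
Qed.

(** The separation hypothesis of the vertical isotopy is checked near each pair of
    parameters and made uniform by compactness. *)
Lemma torus_curve_equiv : knot_equiv (curve w phi) (curve w' phi').
Proof.
have [k [k1 sep]] : exists k : R, 1 <= k /\
    forall q, (`[0 : R, 1] `*` `[0 : R, 1]) q -> separated k q.
  apply: compact_uniform_bound; first exact: segment_square_compact.
  move=> p _; have [D0|D0] := ltP 0 (shadow_dist p.1 p.2); first exact: separated_far.
  case: (boolP (p.1 - p.2 \is a Num.int)) => pint; first exact: separated_near.
  apply: separated_crossing => //.
  by apply/eqP; rewrite eq_le D0 shadow_dist_ge0.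
have k0 : 0 < k by lra.
have kinv : k^-1 <= k by rewrite (le_trans _ k1) // invf_le1.
have [|i j z0le|H hH e] := @vertical_isotopy R R 0 X Y z0 z1 k^-1 k k _ kinv (ltW k0).
- by rewrite invr_gt0.
- have /= := sep (frac i, frac j); rewrite /separated /shadow_dist /=.
  rewrite !(periodic_frac annulus_x_D1) !(periodic_frac annulus_y_D1).
  rewrite /z0 /z1 !(periodic_frac (level_D1 _ tw)) !(periodic_frac (level_D1 _ tw')).
  apply => //; rewrite !in_itv /=.
  by have := frac_itv i; have := frac_itv j; split; lra.
apply: (@knot_equiv_loops _ H id) => //.
- exact: reparam_id.
- exact: torus_curve_D1.
Qed.

End Two.

End CurveIsotopy.

(** * Independence of the phase *)

Section Phases.
Context (R : realType) (s n m : nat).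
Hypotheses (s0 : (0 < s)%N) (n0 : (0 < n)%N) (m0 : (0 < m)%N).
Hypotheses (sn : coprime s n) (sm : coprime s m).
Local Notation R3 := (R * R * R)%type.
Local Notation X := (@annulus_x R s n).
Local Notation Y := (@annulus_y R s n).
Local Notation level := (@level R m).
Local Notation tame := (@tame R s n m).
Local Notation singular := (@singular R s n m).
Local Notation curve := (@torus_curve R s n m).
Local Notation N := (n %/ gcdn n m)%N.
Implicit Types (x y phi : R) (w : R -> R).

Let sR : 0 < s%:R :> R. Proof. by rewrite ltr0n. Qed.
Let nR : 0 < n%:R :> R. Proof. by rewrite ltr0n. Qed.
Let mR : 0 < m%:R :> R. Proof. by rewrite ltr0n. Qed.
Let d0 : (0 < gcdn n m)%N. Proof. by rewrite gcdn_gt0 n0. Qed.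
Let N0 : (0 < N)%N. Proof. by rewrite divn_gt0 // dvdn_leq // dvdn_gcdl. Qed.
Let NR : 0 < N%:R :> R. Proof. by rewrite ltr0n. Qed.

Lemma torus_curve_knot w phi : tame w -> ~ singular phi -> is_knot (curve w phi).
Proof.
move=> tw ns; apply/(loop_knotP (continuous_torus_curve (phi := phi) tw) (torus_curve_D1 n0 phi tw)).
move=> x y [ex ey el].
have [sxy [//|nxy]] := double_point s0 sn ex ey.
apply: contraT => xy.
by have /eqP[] := levels_differ s0 n0 m0 sm tw ns sxy nxy xy; exact: el.
Qed.

(** Bezout: the steps m j/n that come from shifting the parameter reach, modulo 1,
    every multiple of gcd(n, m)/n. *)
Lemma phase_step (l : int) : exists j k : int,
  l%:~R / N%:R = m%:R * (j%:~R / n%:R) + k%:~R :> R.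
Proof.
set d := gcdn n m.
have eN : (N * d)%N = n by rewrite divnK // dvdn_gcdl.
have em : (m %/ d * d)%N = m by rewrite divnK // dvdn_gcdr.
have m'0 : (0 < m %/ d)%N by rewrite divn_gt0 // dvdn_leq // dvdn_gcdr.
have co : coprime (m %/ d) N.
  rewrite /coprime -(eqn_pmul2r d0) mul1n muln_gcdl -/d.
  by rewrite eN em gcdnC.
case: (egcdnP N m'0) => u v; rewrite (eqP co) => euv _.
exists (u%:Z * l), (- (v%:Z * l)).
have eR : (m %/ d)%:R * u%:R = v%:R * N%:R + 1 :> R.
  by rewrite -!natrM mulnC euv natrD.
have dR : 0 < d%:R :> R by rewrite ltr0n.
have -> : m%:R = (m %/ d)%:R * d%:R :> R by rewrite -natrM em.
have -> : n%:R = N%:R * d%:R :> R by rewrite -natrM eN.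
rewrite intrN !intrM /=.
have -> : (m %/ d)%:R * d%:R * (u%:~R * l%:~R / (N%:R * d%:R)) =
    (m %/ d)%:R * u%:R * l%:~R / N%:R :> R by field; rewrite !gt_eqF.
by rewrite eR; field; rewrite gt_eqF.
Qed.

(** The self-intersection is exhibited: parameters with difference 1/s and sum j/n,
    where j is chosen so that m j/n + 2 phi is an integer. *)
Lemma singular_not_knot w phi : tame w -> singular phi -> ~ is_knot (curve w phi).
Proof.
move=> tw [s1 /intrP[l hl]].
move=> /(loop_knotP (continuous_torus_curve (phi := phi) tw) (torus_curve_D1 n0 phi tw)) inj.
have [j [k hjk]] := phase_step (- l).
(* Double points have difference in (1/s)Z and sum in (1/n)Z; these are the
   values 1/s and j/n. *)
pose a : R := (j%:~R / n%:R + s%:R^-1) / 2; pose b : R := (j%:~R / n%:R - s%:R^-1) / 2.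
have ab : a - b = s%:R^-1 by rewrite /a /b; field; rewrite !gt_eqF.
have ab' : a + b = j%:~R / n%:R by rewrite /a /b; field; rewrite !gt_eqF.
have sab : s%:R * (a - b) \is a Num.int by rewrite ab divff ?gt_eqF ?rpred1.
have nab : n%:R * (a + b) \is a Num.int by rewrite ab' mulrC divfK ?gt_eqF ?intr_int.
have ewab := tame_reflect n0 tw nab.
have phi2 : 2 * phi = l%:~R / N%:R by rewrite -hl mulfK // gt_eqF.
have : a - b \is a Num.int.
  apply: inj; rewrite /torus_curve /annulus_x /annulus_y.
  rewrite (@g_neg _ (n%:R * a) (n%:R * b)) -?mulrDr //.
  rewrite (@cos_turn_int _ (s%:R * a) (s%:R * b)) -?mulrBr //.
  rewrite (@sin_turn_int _ (s%:R * a) (s%:R * b)) -?mulrBr //.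
  congr (_, _); apply: g_neg.
  have -> : m%:R * w a + phi + (m%:R * w b + phi) = m%:R * (w a + w b) + 2 * phi by ring.
  rewrite ewab ab' phi2.
  have -> : m%:R * (j%:~R / n%:R) + l%:~R / N%:R = - k%:~R :> R.
    by move: hjk; rewrite intrN mulNr; lra.
  by rewrite rpredN intr_int.
rewrite ab => /int_lt1 h; suff : (s%:R^-1 : R) = 0 by apply/eqP; rewrite invr_eq0 gt_eqF.
by apply: h; rewrite ger0_norm ?invr_ge0 ?ltW // invf_lt1 // ltr1n.
Qed.

Lemma torus_curve_knotP w phi : tame w -> is_knot (curve w phi) <-> ~ singular phi.
Proof.
move=> tw; split; last exact: torus_curve_knot.
by move=> h sing; exact: (singular_not_knot tw sing h).
Qed.

Let tid : tame id. Proof. exact: tame_id. Qed.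

Lemma torus_curve_closed w phi : tame w -> closed_curve (curve w phi).
Proof. by move=> tw; rewrite /closed_curve -(torus_curve_D1 n0 phi tw) add0r. Qed.

Lemma reparam_translate (a : R) : circle_reparam (fun t => t + a).
Proof.
split; last by move=> t; rewrite addrAC.
  by move=> t; apply: cvgD; [exact: cvg_id|exact: cvg_cst].
by move=> x y xy; rewrite ltrD2r.
Qed.

(** The shift t -> t + j/n is a symmetry of the radius, rotates the angle and adds
    m j/n to the phase. *)
Lemma phase_shift_equiv (j : int) phi :
  knot_equiv (curve id (phi + m%:R * (j%:~R / n%:R))) (curve id phi).
Proof.
apply: (@knot_equiv_loops _ (turn_z (2 * pi * s%:R * (j%:~R / n%:R))) (fun t => t + j%:~R / n%:R)).
- exact: turn_z_isotopy.
- exact: reparam_translate.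
- exact: torus_curve_D1.
move=> t; rewrite turn_z_polar /torus_curve /annulus_x /annulus_y.
rewrite (@g_int _ (n%:R * (t + j%:~R / n%:R)) (n%:R * t)); last first.
  have -> : n%:R * (t + j%:~R / n%:R) - n%:R * t = j%:~R :> R.
    by field; rewrite gt_eqF.
  exact: intr_int.
have -> : 2 * pi * (s%:R * (t + j%:~R / n%:R)) =
  2 * pi * (s%:R * t) + 2 * pi * s%:R * (j%:~R / n%:R) :> R by ring.
by congr (_, _, _); rewrite /level; congr g; ring.
Qed.

Lemma phase_period (k : int) w phi : curve w (phi + k%:~R) = curve w phi.
Proof.
apply/funext => t; rewrite /torus_curve; congr (_, _, _); apply: g_int.
have -> : m%:R * w t + (phi + k%:~R) - (m%:R * w t + phi) = k%:~R by ring.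
exact: intr_int.
Qed.

Lemma phase_shift (l : int) phi :
  knot_equiv (curve id (phi + l%:~R / N%:R)) (curve id phi).
Proof.
have [j [k ->]] := phase_step l.
by rewrite addrA phase_period; exact: phase_shift_equiv.
Qed.

(** The shift is replaced by t -> - t, which reflects the plane; with a half turn in
    space this becomes reversal and mirror image. *)
Lemma phase_opp phi : knot_eq (curve id (- phi)) (curve id phi).
Proof.
apply/knot_eqP; exists true, true.
apply: (@knot_equiv_loops _ (turn_x pi) id).
- exact: turn_x_isotopy.
- exact: reparam_id.
- move=> t; rewrite /symmetric_copy /knot_reverse knot_mirrorE; congr mirror3.
  apply: (periodic_int (torus_curve_D1 n0 phi tid)).
  have -> : 1 - (t + 1) - (1 - t) = -1 :> R by ring.
  by rewrite rpredN rpred1.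
move=> t; rewrite /symmetric_copy /knot_reverse knot_mirrorE.
have -> : curve id phi (1 - t) = curve id phi (- t).
  by apply: (periodic_int (torus_curve_D1 n0 phi tid)); rewrite opprK subrK rpred1.
rewrite /torus_curve turn_x_half /mirror3 /= /annulus_x /annulus_y /level.
rewrite !mulrN cosN sinN gN; congr (_, _, _); first by ring.
by congr (- _); rewrite -gN; congr g; ring.
Qed.

(** The midpoint of the first interval between singular phases. *)
Definition base_phase : R := (4 * N%:R)^-1.

Let base_half (a b tau : R) : 0 < 2 * a * N%:R < 1 -> 0 < 2 * b * N%:R < 1 ->
  0 <= tau <= 1 -> ~ singular ((1 - tau) * a + tau * b).
Proof.
move=> /andP[a0 a1] /andP[b0 b1] /andP[t0 t1] [_ /int_lt1 h].
set A := 2 * a * N%:R in a0 a1; set B := 2 * b * N%:R in b0 b1.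
have e : 2 * ((1 - tau) * a + tau * b) * N%:R = (1 - tau) * A + tau * B by rewrite /A /B; ring.
rewrite e in h; have t1' : 0 <= 1 - tau by lra.
have pos : 0 < (1 - tau) * A + tau * B.
  have [->|t0'] := eqVneq tau 0; first by rewrite subr0 mul1r mul0r addr0.
  have t0'' : 0 < tau by rewrite lt_neqAle eq_sym t0'.
  by have := mulr_gt0 t0'' b0; have := mulr_ge0 t1' (ltW a0); lra.
have lt1 : (1 - tau) * A + tau * B < 1.
  have h1 := ler_wpM2l t1' (ltW a1); have h2 := ler_wpM2l t0 (ltW b1).
  have [->|t0'] := eqVneq tau 0; first by rewrite subr0 mul1r mul0r addr0.
  have t0'' : 0 < tau by rewrite lt_neqAle eq_sym t0'.
  have h3 : tau * B < tau * 1 by rewrite ltr_pM2l.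
  by lra.
by have := h; rewrite gtr0_norm // => /(_ lt1) e0; rewrite e0 ltxx in pos.
Qed.

Lemma base_phase_half : 2 * base_phase * N%:R = 2^-1.
Proof. by rewrite /base_phase; field; rewrite gt_eqF. Qed.

Lemma base_phase_itv : 0 <= base_phase <= 1.
Proof.
have N1 : 1 <= N%:R :> R by rewrite ler1n.
rewrite /base_phase invr_ge0 mulr_ge0 //= invf_le1 ?mulr_gt0 //; lra.
Qed.

Lemma base_phase_nonsingular : ~ singular base_phase.
Proof.
by move=> [_]; rewrite base_phase_half => /int_lt1 h; have := h; rewrite ger0_norm //; lra.
Qed.

(** With N = n / gcd(n, m), the singular phases are the multiples of 1/(2N).  A step of
    1/N brings N phi into [0, 1); if it is larger than 1/2, a change of sign and
    another step bring it into (0, 1/2), where the straight path to the base phase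
    meets no singular phase. *)
Lemma all_phases_equivalent phi : ~ singular phi ->
  knot_eq (curve id phi) (curve id base_phase).
Proof.
move=> ns; have cl p : closed_curve (curve id p) by exact: torus_curve_closed.
have [s1|s1] := ltnP 1 s; last first.
  apply: knot_eq_of_equiv; apply: torus_curve_equiv => // tau _ [].
  by rewrite ltnNge s1.
have half phi' : 0 < 2 * phi' * N%:R < 1 -> knot_eq (curve id phi') (curve id base_phase).
  move=> h; apply: knot_eq_of_equiv; apply: torus_curve_equiv => // tau ht.
  by apply: base_half => //; rewrite base_phase_half; lra.
pose l := Num.floor (phi * N%:R); have := floor_itv (phi * N%:R); rewrite intrD -/l.
set y := phi * N%:R => /andP[l0 l1].
have ny (k : int) : 2 * y != k%:~R.
  by apply/eqP => e; apply: ns; split=> //; rewrite -mulrA -/y e intr_int.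
have y0 : y != l%:~R by have := ny (2 * l); rewrite intrM /=; apply: contraNneq => ->.
have y1 : 2 * y != 2 * l%:~R + 1 by have := ny (2 * l + 1); rewrite intrD intrM.
have Nn0 : N%:R != 0 :> R by rewrite gt_eqF.
have [lt|ge] := ltP (2 * y) (2 * l%:~R + 1).
  have -> : phi = (phi - l%:~R / N%:R) + l%:~R / N%:R by ring.
  apply: (knot_eq_trans (cl _) (knot_eq_of_equiv (phase_shift l _))); apply: half.
  have -> : 2 * (phi - l%:~R / N%:R) * N%:R = 2 * y - 2 * l%:~R by rewrite /y; field.
  have : l%:~R < y by rewrite lt_neqAle eq_sym y0.
  by lra.
pose phi' := (l + 1)%:~R / N%:R - phi.
have -> : phi = - phi' + (l + 1)%:~R / N%:R by rewrite /phi'; ring.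
apply: (knot_eq_trans (cl _) (knot_eq_of_equiv (phase_shift (l + 1) _))).
apply: (knot_eq_trans (cl _) (phase_opp _)); apply: half.
have -> : 2 * phi' * N%:R = 2 * (l%:~R + 1) - 2 * y by rewrite /phi' /y intrD; field.
have : 2 * l%:~R + 1 < 2 * y by rewrite lt_neqAle eq_sym y1.
by lra.
Qed.

Lemma frac_mod (x : R) : frac x - x \is a Num.int.
Proof. by rewrite -opprB rpredN fracB_int. Qed.

Lemma T_curveE phi : T_curve s n m phi = curve id phi.
Proof.
apply/funext => t; rewrite /T_curve /VT_embed /torus_curve /annulus_x /annulus_y.
by rewrite (cos_turn_int (frac_mod _)) (sin_turn_int (frac_mod _)).
Qed.

Lemma base_T_knot : T_knot s n m (curve id base_phase).
Proof.
have kb := torus_curve_knot tid base_phase_nonsingular.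
split=> //.
  by exists base_phase; rewrite ?base_phase_itv // T_curveE.
move=> phi _; rewrite T_curveE => /(torus_curve_knotP _ tid); exact: all_phases_equivalent.
Qed.

End Phases.

(** * Arclength against angle along a chord *)

Section Chord.
Context (R : realType) (h : R).
Hypothesis h_itv : 0 < h < pi / 2.
Implicit Types (v x y : R).

Let h0 : 0 < h. Proof. by case/andP: h_itv. Qed.

Lemma cos_ge_end v : `|v| <= h -> cos h <= cos v.
Proof.
move=> vh; rewrite -(cos_norm v).
have [hpi0 hpi1] : 0 <= h /\ h <= pi.
  by case/andP: h_itv => ? ?; split; [lra|have := pi_gt0 R; lra].
rewrite le_eqVlt in vh; case/predU1P: vh => [->//|vh].
by rewrite ltW // ltr_cos // in_itv /= ?hpi0 ?hpi1 ?normr_ge0 //=; lra.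
Qed.

Lemma cos_end_gt0 : 0 < cos h.
Proof. by apply: cos_gt0_pihalf; case/andP: h_itv => ? ?; lra. Qed.

Lemma tan_slope v v' : - h <= v -> v <= v' -> v' <= h ->
  exists K, [/\ 0 < K, K <= (cos h)^-2 & tan v' - tan v = K * (v' - v)].
Proof.
move=> hv vv' v'h; have ch := cos_end_gt0.
have cge c : c \in `[v, v'] -> cos h <= cos c.
  by rewrite in_itv /= => /andP[c1 c2]; apply: cos_ge_end; rewrite ler_norml; lra.
have cgt c : c \in `[v, v'] -> 0 < cos c by move=> /cge; exact: lt_le_trans.
have [||c cin e] := @MVT_segment R tan (fun x => (cos x)^-2) v v' vv'.
- move=> x xin; apply: is_derive_tan; rewrite gt_eqF // cgt //.
  by move: xin; rewrite !in_itv /= => /andP[? ?]; lra.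
- apply: continuous_in_subspaceT => x; rewrite inE /= => xin.
  by apply: continuous_tan; rewrite gt_eqF // cgt.
exists ((cos c)^-2); split=> //; first by rewrite invr_gt0 exprn_gt0 // cgt.
have cc := cgt _ cin.
by rewrite lef_pV2 ?posrE ?exprn_gt0 // ler_pXn2r ?nnegrE ?(ltW cc) ?(ltW ch) // cge.
Qed.

Lemma tan_end_gt0 : 0 < tan h.
Proof.
have [|||K [K0 _]] := @tan_slope 0 h; [by rewrite oppr_le0 ltW|exact: ltW|by []|].
by rewrite tan0 !subr0 => ->; rewrite mulr_gt0.
Qed.

(** A chord subtends the angle 2h at the centre.  The ray at angle h v from the middle
    of the chord cuts it at the fraction chord v of its half length. *)
Definition chord v : R := tan (h * v) / tan h.

Lemma chordN v : chord (- v) = - chord v.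
Proof. by rewrite /chord mulrN tanN mulNr. Qed.

Lemma chord1 : chord 1 = 1.
Proof. by rewrite /chord mulr1 divff // gt_eqF // tan_end_gt0. Qed.

Lemma chord_slope v v' : -1 <= v -> v <= v' -> v' <= 1 ->
  exists K, [/\ 0 < K, K <= (cos h)^-2 * h / tan h & chord v' - chord v = K * (v' - v)].
Proof.
move=> v1 vv' v'1; have t0 := tan_end_gt0.
have [|||K [K0 K1 e]] := @tan_slope (h * v) (h * v').
- by rewrite -[leLHS]mulr1 mulNr -mulrN ler_pM2l.
- by rewrite ler_pM2l.
- by rewrite -[leRHS]mulr1 ler_pM2l.
exists (K * h / tan h); split; first by rewrite divr_gt0 // mulr_gt0.
  by rewrite ler_pM2r ?invr_gt0 // ler_pM2r.
rewrite /chord -mulrBl e; field; by rewrite gt_eqF.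
Qed.

Lemma chord_incr v v' : -1 <= v -> v < v' -> v' <= 1 -> chord v < chord v'.
Proof.
move=> v1 vv' v'1; have [K [K0 _ e]] := chord_slope v1 (ltW vv') v'1.
by rewrite -subr_gt0 e mulr_gt0 // subr_gt0.
Qed.

(** The number of edges, with fractional part, that has been travelled along the
    polygon when the angle swept corresponds to y edges. *)
Definition lag y : R := (Num.floor y)%:~R + (1 + chord (2 * frac y - 1)) / 2.

(** As for the wave g, the right endpoint of the cell is included. *)
Lemma lag_cell (k : int) y : k%:~R <= y <= k%:~R + 1 ->
  lag y = k%:~R + (1 + chord (2 * (y - k%:~R) - 1)) / 2.
Proof.
move=> /andP[ky]; rewrite /lag le_eqVlt => /predU1P[->|yk]; last first.
  by have [|-> ->] := @floor_frac_unique _ y k; rewrite ?ky.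
have [|-> ->] := @floor_frac_unique R (k%:~R + 1) (k + 1); rewrite ?intrD ?lexx ?ltrDl //=.
rewrite !subrr mulr0 sub0r chordN chord1.
have -> : 2 * (k%:~R + 1 - k%:~R) - 1 = 1 :> R by ring.
by rewrite chord1; field.
Qed.

Lemma lag_int (k : int) : lag k%:~R = k%:~R.
Proof.
rewrite (@lag_cell k); last by rewrite lexx lerDl ler01.
by rewrite subrr mulr0 sub0r chordN chord1; field.
Qed.

Lemma lag_incr : {homo lag : x y / x < y}.
Proof.
have incell (k : int) x y : k%:~R <= x -> x < y -> y <= k%:~R + 1 -> lag x < lag y.
  move=> kx xy yk; rewrite !(@lag_cell k); [|lra..].
  have := @chord_incr (2 * (x - k%:~R) - 1) (2 * (y - k%:~R) - 1).
  set cx := chord _; set cy := chord _ => hc.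
  have : cx < cy by apply: hc; lra.
  by lra.
move=> x y xy; have /andP[x1 x2] := floor_itv x; have /andP[y1 y2] := floor_itv y.
set k := Num.floor x in x1 x2; set l := Num.floor y in y1 y2.
rewrite intrD /= in x2; rewrite intrD /= in y2.
have [yk|ky] := leP y (k%:~R + 1); first exact: incell x1 xy yk.
have kl : (k + 1)%:~R <= l%:~R :> R.
  by rewrite ler_int floor_ge_int_tmp intrD ltW.
rewrite intrD /= in kl.
have lk : lag x < k%:~R + 1.
  have := @lag_int (k + 1); rewrite intrD /= => <-.
  exact: incell x1 x2 (lexx _).
apply: (lt_le_trans lk); apply: (le_trans kl); rewrite -[leLHS]lag_int.
have [->|ne] := eqVneq y l%:~R; first exact: lexx.
by apply/ltW/(@incell l) => //; [rewrite lt_neqAle eq_sym ne|exact: ltW].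
Qed.

Lemma lagD1 y : lag (y + 1) = lag y + 1.
Proof.
have := floor_itv y; rewrite intrD /=; set k := Num.floor y => hk.
rewrite (@lag_cell (k + 1)) ?(@lag_cell k) ?intrD /=; [|lra..].
have -> : y + 1 - (k%:~R + 1) = y - k%:~R by ring.
by ring.
Qed.

Lemma lagN y : lag (- y) = - lag y.
Proof.
have := floor_itv y; rewrite intrD /=; set k := Num.floor y => hk.
rewrite (@lag_cell (- k - 1)) ?(@lag_cell k) ?intrB ?intrN /=; [|lra..].
have -> : 2 * (- y - (- k%:~R - 1)) - 1 = - (2 * (y - k%:~R) - 1) by ring.
by rewrite chordN; field.
Qed.

Lemma lag_lipschitz x y : `|x - y| <= 1 ->
  `|lag x - lag y| <= (cos h)^-2 * h / tan h * `|x - y|.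
Proof.
apply: cellwise_lipschitz => k {}x {}y; wlog xy : x y / x <= y => [wl hx hy|].
  by case: (leP x y) => [|/ltW] xy; [|rewrite (distrC (lag x)) (distrC x)]; exact: wl.
move=> hx hy; rewrite !(@lag_cell k) // [X in X <= _]distrC (distrC x).
have [|||K [K0 K1 e]] := @chord_slope (2 * (x - k%:~R) - 1) (2 * (y - k%:~R) - 1); [lra..|].
set cy := chord _ in e *; set cx := chord _ in e *.
have -> : k%:~R + (1 + cy) / 2 - (k%:~R + (1 + cx) / 2) = (cy - cx) / 2 by field.
rewrite e; have -> : K * (2 * (y - k%:~R) - 1 - (2 * (x - k%:~R) - 1)) / 2 = K * (y - x) by field.
by rewrite normrM (gtr0_norm K0) ler_wpM2r.
Qed.

Lemma lag_near e : (forall v, -1 <= v <= 1 -> `|chord v - v| <= e) ->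
  forall y, `|lag y - y| <= e.
Proof.
move=> ce y; have /andP[f0 f1] := frac_itv y.
have -> : lag y - y = (chord (2 * frac y - 1) - (2 * frac y - 1)) / 2.
  rewrite /lag; have -> : (Num.floor y)%:~R = y - frac y by rewrite /frac; ring.
  by field.
have /ce c1 : -1 <= 2 * frac y - 1 <= 1 by lra.
rewrite normrM (@ger0_norm _ 2^-1) ?invr_ge0 //.
by have := normr_ge0 (chord (2 * frac y - 1) - (2 * frac y - 1)); lra.
Qed.

End Chord.

(** As h tends to 0 the tangent becomes linear, uniformly for v in [-1, 1]. *)
Lemma chord_near (R : realType) (e : R) : 0 < e -> exists2 d, 0 < d &
  forall h, 0 < h < d -> forall v, -1 <= v <= 1 -> `|chord h v - v| <= e.
Proof.
move=> e0.
have ht : is_derive (0 : R) (1 : R) tan (1 : R).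
  have : cos (0 : R) != 0 by rewrite cos0 oner_neq0.
  by move=> /is_derive_tan; rewrite cos0 expr1n invr1.
pose e1 := Num.min (e / 4) 2^-1.
have e10 : 0 < e1 by rewrite lt_min divr_gt0 //= invr_gt0.
have [d d0 hd] := unit_derivative_at0 ht (tan0 R) e10.
exists d => // h /andP[h0 hlt] v hv.
have hv1 : `|v| <= 1 by rewrite ler_norml.
have nhv : `|h * v| <= h by rewrite normrM gtr0_norm // ger_pMr.
have b1 : `|tan (h * v) - h * v| <= e1 * h.
  by apply: (le_trans (hd _ (le_lt_trans nhv hlt))); rewrite ler_pM2l.
have b2 : `|tan h - h| <= e1 * h.
  by rewrite -{3}(gtr0_norm h0); apply: hd; rewrite gtr0_norm.
have e1h : e1 * h <= 2^-1 * h by rewrite ler_pM2r // ge_min lexx orbT.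
have th : 2^-1 * h <= tan h by move: b2; rewrite ler_norml; lra.
have th0 : 0 < tan h by apply: lt_le_trans th; rewrite mulr_gt0 ?invr_gt0.
have -> : chord h v - v = (tan (h * v) - h * v - v * (tan h - h)) / tan h.
  by rewrite /chord; field; rewrite gt_eqF.
rewrite normrM normfV (gtr0_norm th0) ler_pdivrMr //.
apply: (le_trans (ler_normB _ _)); rewrite normrM.
have b3 : `|v| * `|tan h - h| <= 1 * (e1 * h) by rewrite ler_pM.
have e1e : e1 * h <= (e / 4) * h by rewrite ler_pM2r // ge_min lexx.
have := ler_wpM2l (ltW e0) th; lra.
Qed.

(** * Polar coordinates and transfer of knots *)

Section Polar.
Context (R : realType).

(** Otherwise f would take the value 1/2 or -1/2. *)
Lemma int_valued_continuous_constant (f : R -> R) :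
  {within `[0, 1], continuous f} -> f 0 = 0 ->
  (forall t, 0 <= t <= 1 -> f t \is a Num.int) -> forall t, 0 <= t <= 1 -> f t = 0.
Proof.
move=> cf f0 fint t ht; apply/eqP; apply: contraT => ft0.
have cft : {within `[0, t], continuous f}.
  apply: continuous_subspaceW cf => x; rewrite /= !in_itv /=; lra.
have t0 : 0 <= t by lra.
(* Half of the sign of f t lies between 0 and f t. *)
pose v := f t / (2 * `|f t|).
have nf : 0 < `|f t| by rewrite normr_gt0.
have nf1 : 1 <= `|f t|.
  by rewrite leNgt; apply/negP => /(int_lt1 (fint t ht))/eqP; rewrite (negbTE ft0).
have nv : `|v| = 2^-1.
  rewrite /v normrM normfV normrM normr_id (@ger0_norm _ 2) //; field.
  by rewrite gt_eqF.
have [|c c0t fc] := @IVT R f 0 t v t0 cft.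
  rewrite f0 ge_min le_max; have [fp|fn] := leP 0 (f t).
    rewrite /v (ger0_norm fp); rewrite (ger0_norm fp) in nf nf1.
    have -> : f t / (2 * f t) = 2^-1 by field; rewrite gt_eqF.
    by rewrite invr_ge0 ler0n /=; apply/orP; right; lra.
  rewrite /v (ltr0_norm fn); rewrite (ltr0_norm fn) in nf nf1.
  have -> : f t / (2 * - f t) = - 2^-1 by field; rewrite lt_eqF.
  by apply/andP; split; apply/orP; [right|left]; lra.
have hc : 0 <= c <= 1 by move: c0t; rewrite in_itv /=; lra.
have := fint c hc; rewrite fc => /int_lt1; rewrite nv => h.
by have v0 : v = 0 by [apply: h; lra]; move: nv; rewrite v0 normr0; lra.
Qed.

(** Two continuous angles differ by an integer number of turns, which is constant and
    vanishes at 0. *)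
Lemma polar_lift_unique (P : R -> R * R) r th r' th' :
  polar_lift P r th -> polar_lift P r' th' ->
  forall t, 0 <= t <= 1 -> r t = r' t /\ th t = th' t.
Proof.
move=> [cth th0 lift] [cth' th'0 lift'].
have eqr t : 0 <= t <= 1 -> r t = r' t.
  move=> ht; have [r0 e] := lift t ht; have [r'0 e'] := lift' t ht.
  move: e; rewrite e' => -[ec es].
  have : r' t ^+ 2 = r t ^+ 2.
    by rewrite -[LHS]mulr1 -(cos2Dsin2 (th' t)) mulrDr -!exprMn ec es !exprMn -mulrDr cos2Dsin2 mulr1.
  by move=> /eqP; rewrite eqrXn2 ?ltW // => /eqP.
pose f t := (th t - th' t) / (2 * pi).
have pi0 := pi_gt0 R.
have f0 t : 0 <= t <= 1 -> f t = 0.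
  apply: int_valued_continuous_constant.
  - move=> x; apply: cvgM; last exact: cvg_cst.
    by apply: cvgB; [exact: cth|exact: cth'].
  - by rewrite /f th0 th'0 subrr mul0r.
  - move=> u hu; have [r0 e] := lift u hu; have [r'0 e'] := lift' u hu.
    move: e; rewrite e' -(eqr u hu) => -[/(mulfI (lt0r_neq0 r0)) ec /(mulfI (lt0r_neq0 r0)) es].
    exact: cos_sin_eq.
move=> t ht; split; first exact: eqr.
have := f0 t ht; rewrite /f => /eqP; rewrite mulf_eq0 invr_eq0 subr_eq0.
by rewrite [2 * pi == 0]gt_eqF ?mulr_gt0 // orbF => /eqP.
Qed.

End Polar.

Section LoopTransfer.
Context (R : realType).
Local Notation R3 := (R * R * R)%type.

(** Embeddedness is invariant under an injective map of space and a change of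
    parameter of the circle. *)
Lemma loop_knot_transfer (c1 c2 : R -> R3) (f : R3 -> R3) (u : R -> R) :
  continuous c1 -> periodic1 c1 -> continuous c2 -> periodic1 c2 ->
  injective f -> circle_reparam u -> (forall t, f (c1 t) = c2 (u t)) ->
  is_knot c1 <-> is_knot c2.
Proof.
move=> cc1 p1 cc2 p2 finj hu e.
have [v [hv uK vK]] := reparam_inverse hu.
rewrite (loop_knotP cc1 p1) (loop_knotP cc2 p2); split=> inj x y exy.
  rewrite -(vK x) -(vK y); apply: reparam_int => //; apply: inj.
  by apply: finj; rewrite !e !vK.
rewrite -(uK x) -(uK y); apply: reparam_int => //; apply: inj.
by rewrite -!e exy.
Qed.

End LoopTransfer.

(** * The radial stretch from the annulus to the polygon *)

Section RadialProfile.
Context (R : realType) (h : R).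
Hypothesis h_itv : 0 < h < pi / 2.

Let mu (r : R) : R := Num.max 1 (Num.min r 2).

(** For a radius 1 + q with q in [0, 1] the product with this factor is
    cos h / cos(h q), the distance from the centre to the point of the chord in the
    direction h q from its middle.  Outside [1, 2] the radius is clamped, which makes
    the stretch linear there and defined on all of space. *)
Definition chord_scale (r : R) : R := cos h / (mu r * cos (h * (mu r - 1))).

Let mu_itv r : 1 <= mu r <= 2.
Proof. by rewrite /mu le_max lexx ge_max ge_min lexx orbT ler1n. Qed.

Let h0 : 0 < h. Proof. by case/andP: h_itv. Qed.

Let cos_mu r : cos h <= cos (h * (mu r - 1)) <= 1.
Proof.
have := mu_itv r => hm; rewrite (le_trans (ler_norm _) (cos_max _)) andbT.
apply: cos_ge_end => //; rewrite normrM (gtr0_norm h0) ger_pMr //.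
by rewrite ger0_norm; lra.
Qed.

Let ch : 0 < cos h. Proof. exact: cos_end_gt0. Qed.
Let den_gt0 r : 0 < mu r * cos (h * (mu r - 1)).
Proof. by have := mu_itv r; have := cos_mu r; have := ch => ? ? ?; rewrite mulr_gt0 //; lra. Qed.

Lemma continuous_chord_scale : continuous chord_scale.
Proof.
have cmu : continuous mu.
  move=> r; apply: (@continuous_max R R (fun=> 1) (fun r => Num.min r 2)); first exact: cvg_cst.
  by apply: (@continuous_min R R id (fun=> 2)); [exact: cvg_id|exact: cvg_cst].
move=> r; apply: cvgM; first exact: cvg_cst.
apply: cvgV; first by rewrite gt_eqF // den_gt0.
apply: cvgM; first exact: cmu.
apply: (@continuous_comp _ _ _ (fun r => h * (mu r - 1)) (@cos R)); last exact: continuous_cos.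
by apply: cvgM; [exact: cvg_cst|apply: cvgB; [exact: cmu|exact: cvg_cst]].
Qed.

Lemma chord_scale_ge r : cos h / 2 <= chord_scale r.
Proof.
rewrite /chord_scale ler_pM2l // lef_pV2 ?posrE ?den_gt0 //.
have /andP[m1 m2] := mu_itv r; have /andP[c1 c2] := cos_mu r.
have c0 : 0 <= cos (h * (mu r - 1)) by rewrite (le_trans (ltW ch)).
by rewrite -[leRHS]mulr1 ler_pM //; lra.
Qed.

(** The product is r / mu(r) times cos h / cos(h (mu(r) - 1)), where mu clamps to
    [1, 2]; the first factor is strictly increasing where the second is constant, and
    conversely. *)
Lemma chord_scale_incr r r' : 0 <= r -> r < r' -> r * chord_scale r < r' * chord_scale r'.
Proof.
move=> r0 rr'.
have split x : x * chord_scale x = x / mu x * (cos h / cos (h * (mu x - 1))).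
  have := den_gt0 x; have /andP[m1 _] := mu_itv x => d0.
  rewrite /chord_scale; field; rewrite -negb_or -mulf_eq0.
  by rewrite gt_eqF // mulrC.
have cpos x : 0 < cos (h * (mu x - 1)) by have /andP[c1 _] := cos_mu x; exact: lt_le_trans c1.
have mule : mu r <= mu r'.
  rewrite /mu ge_max le_max lexx /= le_max; apply/orP; right.
  by rewrite le_min !ge_min (ltW rr') lexx orbT.
have pos2 x : 0 < cos h / cos (h * (mu x - 1)) by rewrite divr_gt0.
have hin x : h * (mu x - 1) \in `[0, pi].
  have := mu_itv x => /andP[m1 m2]; have pi0 := pi_gt0 R.
  rewrite in_itv /=; apply/andP; split; first by rewrite mulr_ge0 ?(ltW h0) // subr_ge0.
  have : h * (mu x - 1) <= h * 1 by rewrite ler_pM2l //; lra.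
  by case/andP: h_itv => ? ?; lra.
have p_lt : mu r < mu r' ->
    cos h / cos (h * (mu r - 1)) < cos h / cos (h * (mu r' - 1)).
  move=> lt; rewrite ltr_pM2l // ltf_pV2 ?posrE //.
  by rewrite ltr_cos // ltr_pM2l // ltrD2r.
have p_le : cos h / cos (h * (mu r - 1)) <= cos h / cos (h * (mu r' - 1)).
  by move: mule; rewrite le_eqVlt => /predU1P[->//|/p_lt/ltW].
have muE x : [/\ x <= 1 -> mu x = 1, 1 <= x <= 2 -> mu x = x & 2 <= x -> mu x = 2].
  rewrite /mu; split.
  - by move=> x1; rewrite (@min_l _ _ x) ?max_l //; lra.
  - by move=> /andP[x1 x2]; rewrite min_l ?max_r.
  - by move=> x2; rewrite min_r // max_r // ler1n.
have [m1 m2 m3] := muE r; have [m1' m2' m3'] := muE r'.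
rewrite !split.
have q0 : 0 <= r / mu r by rewrite divr_ge0 //; have := mu_itv r; lra.
have both_q : r / mu r < r' / mu r' ->
    r / mu r * (cos h / cos (h * (mu r - 1))) < r' / mu r' * (cos h / cos (h * (mu r' - 1))).
  move=> q; apply: (@le_lt_trans _ _ (r / mu r * (cos h / cos (h * (mu r' - 1))))).
    by rewrite ler_wpM2l.
  by rewrite ltr_pM2r.
have [r1|r1] := ltP r 1.
  apply: both_q; rewrite (m1 (ltW r1)) divr1.
  have [r'1|r'1] := leP r' 1; first by rewrite m1' // divr1.
  have [r'2|r'2] := leP r' 2; first by rewrite m2' ?divff ?gt_eqF ?(ltW r'1) //; lra.
  by rewrite m3' ?ltW //; lra.
have [r2|r2] := ltP r 2; last first.
  by apply: both_q; rewrite !(m3, m3') //; lra.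
have mr : mu r = r by apply: m2; rewrite r1 ltW.
have mlt : mu r < mu r'.
  by rewrite mr; have [r'2|r'2] := leP r' 2; [rewrite m2' //|rewrite m3' //]; lra.
have qr : r / mu r = 1 by rewrite mr divff // gt_eqF //; lra.
have qr' : 1 <= r' / mu r'.
  have [r'2|r'2] := leP r' 2; first by rewrite m2' ?divff ?gt_eqF ?lexx //; lra.
  by rewrite m3' ?ltW //; lra.
rewrite qr mul1r; apply: (lt_le_trans (p_lt mlt)).
by rewrite ler_peMl // ltW.
Qed.

Lemma chord_scaleE q : 0 <= q <= 1 -> (1 + q) * chord_scale (1 + q) = cos h / cos (h * q).
Proof.
move=> hq; have em : mu (1 + q) = 1 + q by rewrite /mu min_l ?max_r; lra.
have := den_gt0 (1 + q); rewrite /chord_scale em.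
have -> : 1 + q - 1 = q by ring.
move=> d0; have q0 : 0 < 1 + q by lra.
have c0 : 0 < cos (h * q) by move: d0; rewrite pmulr_rgt0.
by field; rewrite !gt_eqF.
Qed.

End RadialProfile.

(** * Billiard curves in a thin slice *)

Section Slice.
Context (R : realType) (s n m a : nat).
Hypotheses (s0 : (0 < s)%N) (n0 : (0 < n)%N) (m0 : (0 < m)%N) (a0 : (0 < a)%N).
Hypotheses (sn : coprime s n) (sm : coprime s m).
Local Notation R3 := (R * R * R)%type.
Local Notation tame := (@tame R s n m).
Local Notation singular := (@singular R s n m).
Local Notation curve := (@torus_curve R s n m).

(** Half the angle s beta / n of one edge, where beta = 2 pi / a. *)
Definition half_angle : R := pi * s%:R / (a%:R * n%:R).
Local Notation h := half_angle.

Hypothesis h_itv : 0 < h < pi / 2.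

(** The arclength time at which the slice curve has swept the angle 2 pi s x in the
    full cylinder. *)
Definition slice_param (x : R) : R := lag h (n%:R * x) / n%:R.
Local Notation w := slice_param.

Hypothesis chord_close : forall v : R, -1 <= v <= 1 ->
  `|chord h v - v| <= (4 * m%:R * s%:R)^-1.

Let sR : 0 < s%:R :> R. Proof. by rewrite ltr0n. Qed.
Let nR : 0 < n%:R :> R. Proof. by rewrite ltr0n. Qed.
Let mR : 0 < m%:R :> R. Proof. by rewrite ltr0n. Qed.
Let aR : 0 < a%:R :> R. Proof. by rewrite ltr0n. Qed.

Let scaleK x : n%:R * w x = lag h (n%:R * x).
Proof. by rewrite /slice_param mulrC divfK // gt_eqF. Qed.

Let e_itv : (0 : R) < (4 * m%:R * s%:R : R)^-1 <= (1 : R).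
Proof.
rewrite invr_gt0 !mulr_gt0 //= invf_le1 ?mulr_gt0 //.
have : (1 : R) * 1 <= m%:R * s%:R by rewrite ler_pM // ler1n.
by lra.
Qed.

Lemma slice_param_tame : tame w.
Proof.
have near := lag_near chord_close; have /andP[e0 e1] := e_itv.
pose C := (cos h)^-2 * h / tan h.
have C0 : 0 < C.
  rewrite /C divr_gt0 ?tan_end_gt0 // mulr_gt0 ?(andP h_itv).1 //.
  by rewrite invr_gt0 exprn_gt0 // cos_end_gt0.
split.
(* The local estimate covers n |x - y| <= 1; beyond, lag moves points by at most 1. *)
- exists (C + 3); first by rewrite addr_gt0.
  move=> x y _; rewrite -(ler_pM2l nR) -{1}[n%:R](gtr0_norm nR) -normrM mulrBr !scaleK.
  rewrite mulrCA -{3}[n%:R](gtr0_norm nR) -normrM mulrBr.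
  set p := n%:R * x; set q := n%:R * y.
  have [pq|pq] := leP `|p - q| 1.
    by apply: (le_trans (lag_lipschitz h_itv pq)); rewrite ler_wpM2r // lerDl.
  have -> : lag h p - lag h q = (lag h p - p) - (lag h q - q) + (p - q) by ring.
  apply: (le_trans (ler_normD _ _)).
  have := ler_normB (lag h p - p) (lag h q - q).
  have := near p; have := near q.
  have : 0 <= C * `|p - q| by rewrite mulr_ge0 // ltW.
  by lra.
- by move=> x; rewrite /slice_param mulrDr divff ?gt_eqF // lagD1 // mulrDl mul1r.
- by move=> x; rewrite /slice_param mulrN lagN // mulNr.
- move=> x; have -> : w x - x = (lag h (n%:R * x) - n%:R * x) / n%:R.
    by rewrite /slice_param; field; rewrite gt_eqF.
  rewrite normrM normfV (gtr0_norm nR) ltr_pdivrMr //.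
  apply: (le_lt_trans (near _)).
  apply: (@lt_le_trans _ _ (2 * m%:R * s%:R)^-1); last by rewrite ler_peMr ?invr_ge0 ?mulr_ge0 // ler1n.
  by rewrite ltf_pV2 ?posrE ?mulr_gt0 // -!mulrA ltr_pM2r ?mulr_gt0 // ltr_nat.
Qed.

Lemma slice_param_reparam : circle_reparam w.
Proof.
split; first exact: tame_continuous slice_param_tame.
  by move=> x y xy; rewrite ltr_pM2r ?invr_gt0 // lag_incr // ltr_pM2l.
by move=> t; exact: (tame_D1 n0 slice_param_tame t).
Qed.

Definition slice_radius (x : R) : R := cos h / cos (h * g (n%:R * x)).

(** With M the direction of the middle of the current edge, the point is
    cos h e^(iM) + i q sin h e^(iM), where q = tan(h v) / tan h is its position on the
    edge, and this is (cos h / cos(h v)) e^(i(M + h v)). *)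
Lemma slice_pathE (x : R) :
  slice_path s n (2 * pi / a%:R) (w x) =
  (slice_radius x * cos (2 * h * (n%:R * x)), slice_radius x * sin (2 * h * (n%:R * x))).
Proof.
set L := n%:R * w x; have eL : L = lag h (n%:R * x) := scaleK x.
set y := n%:R * x in eL *; set k := Num.floor y; set v := 2 * frac y - 1.
have /andP[f0 f1] := frac_itv y.
have v1 : -1 <= v < 1 by rewrite /v; lra.
have q_itv : -1 <= chord h v < 1.
  have [v1e|v1n] := eqVneq v (-1); first by rewrite v1e chordN chord1 //; lra.
  have v1l : -1 < v by rewrite lt_neqAle eq_sym v1n; case/andP: v1.
  have := chord_incr h_itv (lexx (-1)) v1l; have := chord_incr h_itv (v := v) (v' := 1).
  by rewrite chordN chord1 // => A B; rewrite ltW ?A ?B //; lra.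
have [fL gL] : Num.floor L = k /\ frac L = L - k%:~R.
  by apply: floor_frac_unique; rewrite eL /lag -/k -/v; lra.
rewrite /slice_path -/L fL gL.
have -> : L - k%:~R = (1 + chord h v) / 2 by rewrite eL /lag -/k -/v; ring.
set q := chord h v in q_itv *.
have -> : s%:R * (2 * pi / a%:R) / n%:R = 2 * h.
  by rewrite /half_angle; field; rewrite !gt_eqF.
pose M := 2 * h * k%:~R + h.
have -> : k%:~R * (2 * h) = M - h by rewrite /M; ring.
have -> : (k%:~R + 1) * (2 * h) = M + h by rewrite /M; ring.
have -> : 2 * h * y = M + h * v.
  by rewrite /M /v /frac -/k; ring.
have hv : `|h * v| <= h.
  have [hp _] := andP h_itv; rewrite normrM (gtr0_norm hp) ger_pMr // ler_norml.
  by case/andP: v1 => -> /ltW ->.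
have ev : cos (h * g y) = cos (h * v).
  rewrite -[RHS]cos_norm normrM (gtr0_norm (andP h_itv).1); congr cos; congr (_ * _).
  have -> : v = 2 * (frac y - 2^-1) by rewrite /v; field.
  by rewrite normrM ger0_norm.
have cv0 : 0 < cos (h * v) by apply: lt_le_trans (cos_end_gt0 h_itv) (cos_ge_end h_itv hv).
have ch0 := cos_end_gt0 h_itv.
have qE : q * sin h = sin (h * v) / cos (h * v) * cos h.
  rewrite /q /chord; rewrite [tan (h * v)]/tan [tan h]/tan.
  have sh0 : 0 < sin h.
    by have := tan_end_gt0 h_itv; rewrite /tan pmulr_lgt0 ?invr_gt0.
  by field; rewrite !gt_eqF.
clearbody M; rewrite /slice_radius ev !cosD !sinD cosN sinN.
congr (_, _).
- have -> : (1 - (1 + q) / 2) * (cos M * cos h - sin M * - sin h) +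
     (1 + q) / 2 * (cos M * cos h - sin M * sin h) = cos M * cos h - sin M * (q * sin h) by field.
  by rewrite qE; field; rewrite gt_eqF.
- have -> : (1 - (1 + q) / 2) * (sin M * cos h + cos M * - sin h) +
     (1 + q) / 2 * (sin M * cos h + cos M * sin h) = sin M * cos h + cos M * (q * sin h) by field.
  by rewrite qE; field; rewrite gt_eqF.
Qed.

Variable v : R -> R.
Hypotheses (v_reparam : circle_reparam v) (wK : cancel w v) (vK : cancel v w).

Lemma slice_polar_lift : polar_lift (slice_path s n (2 * pi / a%:R))
  (fun t => slice_radius (v t)) (fun t => 2 * h * (n%:R * v t)).
Proof.
have [cv _ _] := v_reparam.
have w0 : w 0 = 0.
  by rewrite /slice_param mulr0 -[0]/(0%:~R) lag_int // mul0r.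
split.
- apply: continuous_subspaceT => t.
  by apply: cvgM; [exact: cvg_cst|apply: cvgM; [exact: cvg_cst|exact: cv]].
- by rewrite -{1}w0 wK !mulr0.
- move=> t _; split; last by rewrite -{1}(vK t) slice_pathE.
  rewrite /slice_radius divr_gt0 ?(cos_end_gt0 h_itv) //.
  apply: (lt_le_trans (cos_end_gt0 h_itv)); apply: cos_ge_end => //.
  have [hp _] := andP h_itv; have /andP[g0 g1] := g_itv (n%:R * v t).
  by rewrite normrM (gtr0_norm hp) ger_pMr // ger0_norm.
Qed.

(** The curve in the slice as a periodic function on the whole line; v is the inverse
    of the change of parameter w. *)
Definition slice_curve (phi t : R) : R3 := stretch (chord_scale h) 1 (curve w phi (v t)).

Lemma slice_curveE r theta phi t :
  polar_lift (slice_path s n (2 * pi / a%:R)) r theta -> 0 <= t <= 1 ->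
  Z_curve m (2 * pi / a%:R) r theta phi t = slice_curve phi t.
Proof.
move=> lift ht; have [er et] := polar_lift_unique lift slice_polar_lift ht.
have g0 := g_itv (n%:R * v t).
rewrite /slice_curve /torus_curve /annulus_x /annulus_y stretch_polar; last first.
  by case/andP: g0 => g0 _; rewrite addr_ge0.
rewrite chord_scaleE // /Z_curve er et /level vK.
have -> : 2 * pi * (2 * h * (n%:R * v t)) / (2 * pi / a%:R) = 2 * pi * (s%:R * v t).
  rewrite /half_angle; move: (pi_gt0 R); move: (@pi R) => p p0.
  by field; rewrite !gt_eqF.
by [].
Qed.

Let iso : ambient_isotopy (stretch (chord_scale h)).
Proof.
have ch := cos_end_gt0 h_itv.
apply: (@stretch_isotopy _ _ (cos h / 2)).
- exact: continuous_chord_scale.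
- by rewrite divr_gt0.
- by have := cos_max h; rewrite ler_norml; lra.
- by move=> r; exact: chord_scale_ge.
- by move=> r r'; exact: chord_scale_incr.
Qed.

Lemma slice_curve_D1 phi : periodic1 (slice_curve phi).
Proof.
have [_ _ v1] := v_reparam.
by move=> t; rewrite /slice_curve v1 (torus_curve_D1 n0 phi slice_param_tame).
Qed.

Lemma slice_curve_equiv phi : knot_equiv (curve w phi) (slice_curve phi).
Proof.
apply: (knot_equiv_loops iso slice_param_reparam (slice_curve_D1 phi)).
by move=> t; rewrite /slice_curve wK.
Qed.

Lemma slice_curve_knotP phi : is_knot (slice_curve phi) <-> ~ singular phi.
Proof.
have tw := slice_param_tame; have [_ _ hh] := iso.
have [|cs [f' [_ fK _]]] := hh 1; first by rewrite ler01 lexx.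
rewrite -(torus_curve_knotP s0 n0 m0 sn sm phi tw); apply: iff_sym.
apply: (@loop_knot_transfer _ _ _ (stretch (chord_scale h) 1) w).
- exact: continuous_torus_curve.
- exact: torus_curve_D1.
- have [cv _ _] := v_reparam; have cc := continuous_torus_curve (phi := phi) tw.
  move=> t; apply: (@continuous_comp _ _ _ (fun t => curve w phi (v t))); last exact: cs.
  by apply: (@continuous_comp _ _ _ v); [exact: cv|exact: cc].
- exact: slice_curve_D1.
- exact: can_inj fK.
- exact: slice_param_reparam.
- by move=> t; rewrite /slice_curve wK.
Qed.

(** The chain of comparisons: radial stretch, then vertical isotopy from w to the
    identity at the same phase, then change of phase. *)
Lemma slice_curve_eq_base phi : ~ singular phi ->
  knot_eq (slice_curve phi) (curve id (base_phase R n m)).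
Proof.
move=> ns; have tw := slice_param_tame; have tid : tame id by exact: tame_id.
have cl p : closed_curve (curve id p) by exact: torus_curve_closed.
have e1 : knot_eq (slice_curve phi) (curve w phi).
  apply: knot_eq_of_equiv; apply: knot_equiv_sym (slice_curve_equiv phi).
  by rewrite /closed_curve -(slice_curve_D1 phi 0) add0r.
have e2 : knot_eq (curve w phi) (curve id phi).
  apply: knot_eq_of_equiv; apply: torus_curve_equiv => // tau _.
  by have -> : (1 - tau) * phi + tau * phi = phi by ring.
apply: knot_eq_trans e1 _ => //; apply: knot_eq_trans e2 _ => //.
exact: all_phases_equivalent.
Qed.

Lemma base_Z_knot : (2 * s + 1 <= a * n)%N ->
  Z_knot s n m a (curve id (base_phase R n m)).
Proof.
move=> san; split=> //; exists (fun t => slice_radius (v t)), (fun t => 2 * h * (n%:R * v t)).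
split; first exact: slice_polar_lift.
have E phi t (ht : 0 <= t <= 1) := slice_curveE phi slice_polar_lift ht.
have E' phi t : 0 <= t <= 1 -> slice_curve phi t = _ := fun ht => esym (E phi t ht).
split.
- apply: torus_curve_knot => //; first exact: tame_id.
  exact: base_phase_nonsingular.
- exists (base_phase R n m); first exact: base_phase_itv.
  apply: is_knot_ext (E' _) _; apply/slice_curve_knotP.
  exact: base_phase_nonsingular.
- move=> phi _ /(is_knot_ext (E phi)) /slice_curve_knotP /slice_curve_eq_base.
  exact: knot_eq_ext (E' phi) (fun _ _ => erefl).
Qed.

Lemma Z_knot_eq_base (K : R -> R3) :
  Z_knot s n m a K -> knot_eq K (curve id (base_phase R n m)).
Proof.
move=> [_ _ _ [r [theta [lift [kK [phi hphi kphi] KE]]]]].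
have E t := slice_curveE phi lift (t := t).
have E' t : 0 <= t <= 1 -> slice_curve phi t = _ := fun ht => esym (E t ht).
have cl : closed_curve (curve id (base_phase R n m)).
  by apply: torus_curve_closed => //; exact: tame_id.
have sK := is_knot_ext E kphi.
have ek : knot_eq (slice_curve phi) K := knot_eq_ext E (fun _ _ => erefl) (KE phi hphi kphi).
have := knot_eq_sym (knot_closed sK) (knot_closed kK) ek.
move=> /knot_eq_trans; apply => //.
by apply: slice_curve_eq_base; apply/slice_curve_knotP.
Qed.

End Slice.

(** * Stability and the comparison *)

Section Stability.
Context (R : realType) (s n m : nat).
Hypotheses (s0 : (0 < s)%N) (n0 : (0 < n)%N) (m0 : (0 < m)%N).
Hypotheses (sn : coprime s n) (sm : coprime s m).
Local Notation R3 := (R * R * R)%type.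
Local Notation base := (torus_curve s n m id (base_phase R n m)).

(** All conditions on a say that the half angle pi s / (a n) is small. *)
Lemma thin_slices : exists a0 : nat, forall a, (a0 <= a)%N ->
  [/\ (0 < a)%N, (2 * s + 1 <= a * n)%N, 0 < half_angle R s n a < pi / 2 &
      forall v : R, -1 <= v <= 1 ->
        `|chord (half_angle R s n a) v - v| <= (4 * m%:R * s%:R)^-1].
Proof.
have sR : 0 < s%:R :> R by rewrite ltr0n.
have nR : 1 <= n%:R :> R by rewrite ler1n.
have mR : 0 < m%:R :> R by rewrite ltr0n.
have pi0 := pi_gt0 R.
have [|d d0 hd] := @chord_near R (4 * m%:R * s%:R)^-1; first by rewrite invr_gt0 !mulr_gt0.
pose e := Num.min d (pi / 2).
have e0 : 0 < e by rewrite lt_min d0 divr_gt0.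
pose b := pi * s%:R / e.
have b0 : 0 <= b by rewrite divr_ge0 ?mulr_ge0 // ltW.
exists ((2 * s + 1) + (Num.truncn b).+1)%N => a ha.
have a1 : (2 * s + 1 <= a)%N by rewrite (leq_trans _ ha) // leq_addr.
have a0 : (0 < a)%N by rewrite (leq_trans _ a1) // addn1.
have aR : 0 < a%:R :> R by rewrite ltr0n.
have ba : b < a%:R.
  apply: (lt_le_trans (truncnS_gt b)).
  by rewrite ler_nat (leq_trans _ ha) // leq_addl.
have hpos : 0 < half_angle R s n a.
  by rewrite /half_angle divr_gt0 ?mulr_gt0 // (lt_le_trans ltr01).
have he : half_angle R s n a < e.
  rewrite /half_angle ltr_pdivrMr; last by rewrite mulr_gt0 // (lt_le_trans ltr01).
  move: ba; rewrite /b ltr_pdivrMr // => h; apply: (lt_le_trans h).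
  by rewrite [leLHS]mulrC ler_pM2l // ler_peMr // ltW.
move: he; rewrite lt_min => /andP[h1 h2].
split=> //; last by apply: hd; rewrite hpos h1.
  by rewrite (leq_trans a1) // leq_pmulr.
by rewrite hpos h2.
Qed.

Lemma thin_slice_knots : exists a0 : nat, forall a, (a0 <= a)%N ->
  Z_knot s n m a base /\ forall K : R -> R3, Z_knot s n m a K -> knot_eq K base.
Proof.
have [a0 ha0] := thin_slices; exists a0 => a /ha0[a1 san h_itv cl].
have [v [hv wK vK]] := reparam_inverse (slice_param_reparam s0 n0 m0 h_itv cl).
split; first exact: (base_Z_knot s0 n0 m0 a1 sn sm h_itv cl hv wK vK san).
exact: (Z_knot_eq_base s0 n0 m0 a1 sn sm h_itv cl hv wK vK).
Qed.

Let base_T : T_knot s n m base. Proof. exact: base_T_knot. Qed.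

Lemma T_knot_eq_base (K : R -> R3) : T_knot s n m K -> knot_eq K base.
Proof.
move=> [kK [phi hphi kphi] KE].
have [kb _ bE] := base_T.
have := knot_eq_sym (knot_closed kphi) (knot_closed kK) (KE phi hphi kphi).
by move=> /knot_eq_trans; apply; [exact: knot_closed|exact: bE].
Qed.

Lemma Zst_knot_base : Zst_knot s n m base.
Proof. by have [a0 h] := thin_slice_knots; exists a0 => a /h[]. Qed.

Lemma Zst_knot_eq_base (K : R -> R3) : Zst_knot s n m K -> knot_eq K base.
Proof.
have [a0 h] := thin_slice_knots; move=> [a1 h1].
have [_] := h (maxn a0 a1) (leq_maxl _ _); apply.
exact: h1 (leq_maxr _ _).
Qed.

Lemma family_knot_transfer (F : R -> R -> R3) (K K' : R -> R3) :
  knot_of_family F K -> is_knot K' -> knot_eq K K' -> knot_of_family F K'.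
Proof.
move=> [kK ex KE] kK' e; split=> // phi hphi kphi.
exact: knot_eq_trans (knot_closed kK') (KE phi hphi kphi) e.
Qed.

(** Both knots are represented by the base curve. *)
Lemma T_knot_Zst_knot (K : R -> R3) : T_knot s n m K -> Zst_knot s n m K.
Proof.
move=> TK; have [kK _ _] := TK.
have [kb _ _] := base_T.
have e := knot_eq_sym (knot_closed kK) (knot_closed kb) (T_knot_eq_base TK).
have [a0 h] := Zst_knot_base; exists a0 => a /h[c a1 san [r [th [lift fam]]]].
by split=> //; exists r, th; split=> //; exact: family_knot_transfer fam kK e.
Qed.

End Stability.

Theorem theorem4p4p2 (R : realType) :
  (forall s n m : nat, (0 < s)%N -> (0 < n)%N -> (0 < m)%N ->
     coprime s n -> coprime s m ->
     [/\ exists KT : R -> R * R * R, T_knot s n m KT,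
         exists KZ : R -> R * R * R, Zst_knot s n m KZ &
         forall KZ KT : R -> R * R * R,
           Zst_knot s n m KZ -> T_knot s n m KT -> knot_eq KZ KT]) /\
  (forall K : R -> R * R * R,
     flat_torus_billiard_knot K -> stable_cylinder_knot K).
Proof.
split=> [s n m s0 n0 m0 sn sm|K [s [n [m [[s0 n0 m0] [sn sm TK]]]]]]; last first.
  by exists s, n, m; split=> //; split=> //; exact: T_knot_Zst_knot.
have kb := base_T_knot R s0 n0 m0 sn sm.
split.
- by eexists; exact: kb.
- by eexists; exact: (Zst_knot_base R s0 n0 m0 sn sm).
- move=> KZ KT /(Zst_knot_eq_base s0 n0 m0 sn sm) eZ TK.
  have [kT _ _] := TK; have [cb _ _] := kb.
  apply: knot_eq_trans (knot_closed kT) eZ _.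
  apply: knot_eq_sym (knot_closed kT) (knot_closed cb) _.
  exact: T_knot_eq_base.
Qed.
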